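(* Let $X_{\mathrm{tref}}(0)=X(-2/1,3/1,6/1)$, i.e. the 3-manifold obtained by surgery on the left-handed trefoil knot with framing $0$ (the torus bundle over $S^1$ with monodromy matrix $\begin{pmatrix}0&-1\\1&1\end{pmatrix}\in SL(2,\mathbb Z)$). For every odd integer $r\ge3$ with $3\nmid r$, $$\tau'_r\big(X_{\mathrm{tref}}(0)\big)=\begin{cases}0,& r\equiv1\pmod3,\\[4pt]\dfrac{-\sqrt r}{2\sin\frac{\pi}{r}}\,e^{-\frac{2\pi i}{r}},& r\equiv-1\pmod3.\end{cases}$$
   Context: **Seifert manifolds.** For pairs of coprime nonzero integers $(p_k,q_k)$, $X(p_1/q_1,\dots,p_n/q_n)$ is the closed oriented 3-manifold obtained by surgery on $S^3$ along the link consisting of a central unknot with surgery coefficient $0$ and $n$ parallel (unlinked) meridians of it with rational surgery coefficients $p_1/q_1,\dots,p_n/q_n$. **The invariant $\tau'_r$** (Kirby–Melvin's $SO(3)$ invariant, $r\ge3$ odd). Let $s=e^{\pi i/r}$, $t=e^{\pi i/(2r)}$, $[k]=\frac{s^k-s^{-k}}{s-s^{-1}}$. Let $M$ be obtained by surgery on an (integrally) framed link $L\subset S^3$ with $N$ components, whose linking matrix has $b_+$ positive and $b_-$ negative eigenvalues; then $\nu=N-b_+-b_-$ is the first Betti number of $M$. Let $J_{L,\mathbf k}$ be the framed colored Jones invariant of $L$ with component $i$ colored by the $k_i$-dimensional irreducible representation of quantum $sl_2$ at $q=e^{2\pi i/r}$, normalized so that the unknot with framing $a$ has value $t^{a(k^2-1)}[k]$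 (and the Hopf link with framings $0$, colors $k,l$, has value $[kl]$). Put $$F(L)=\sum_{\mathbf k}\Big(\prod_i[k_i]\Big)J_{L,\mathbf k},$$ the sum over all $\mathbf k=(k_1,\dots,k_N)$ with each $k_i$ odd and $0<k_i<r$, and $G_\pm=F(\text{unknot with framing }\pm1)$. Then $$\tau'_r(M)=\Big(\sqrt{\tfrac4r}\,\sin\tfrac{\pi}{r}\Big)^{\nu}\,\frac{F(L)}{G_+^{b_+}G_-^{b_-}}.$$ *)

(* Defs.v *)
From HB Require Import structures.
From mathcomp Require Import all_boot all_order all_fingroup all_algebra.
From mathcomp Require Import complex mxtens.
From mathcomp Require Import reals trigo.

Set Implicit Arguments.
Unset Strict Implicit.
Unset Printing Implicit Defensive.

Import Order.TTheory GRing.Theory Num.Theory.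
Local Open Scope ring_scope.

(** * Framed links

   Every link in S^3 is the closure of a braid (Alexander), so an integrally
   framed link is given by a braid word together with an integer for each
   component.  Braids have [m.+1] strands, at positions [0, ..., m]; the letter
   [(p, true)] is the positive crossing (+1 when both strands point in the braid
   direction) of the strands at positions [p] and [p.+1], and [(p, false)] is
   its inverse. *)

Definition letter (m : nat) := ('I_m * bool)%type.

Definition posl m (p : 'I_m) : 'I_m.+1 := widen_ord (leqnSn m) p.
Definition posr m (p : 'I_m) : 'I_m.+1 := lift ord0 p.

Definition braid_perm m (w : seq (letter m)) : {perm 'I_m.+1} :=
  (\prod_(g <- w) tperm (posl g.1) (posr g.1))%g.

(* [flcomp i] is the component through the strand starting at position [i]. The
   framings are arbitrary integers: they need not be the blackboard framings. *)
Record framed_link := FramedLink {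
  flrank : nat;
  flword : seq (letter flrank);
  flN : nat;
  flcomp : 'I_flrank.+1 -> 'I_flN;
  flframing : 'I_flN -> int;
  flcompP : forall i j,
    (flcomp i == flcomp j) = (j \in porbit (braid_perm flword) i);
  flcomp_surj : forall a, exists i, flcomp i = a
}.

(* Sum of the signs of the crossings between the components [a] and [b]: the
   self-writhe of [a] if [a = b], twice their linking number otherwise. *)
Fixpoint crossing_sum m N (w : seq (letter m)) (c : 'I_m.+1 -> 'I_N)
    (a b : 'I_N) : int :=
  if w is g :: w' then
    let l := posl g.1 in let r := posr g.1 in
    (if ((c l, c r) == (a, b)) || ((c l, c r) == (b, a))
     then (if g.2 then 1 else -1) else 0)
    + crossing_sum w' (fun i => c (tperm l r i)) a b
  else 0.

Definition linking_matrix (L : framed_link) : 'M[int]_(flN L) :=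
  \matrix_(a, b) if a == b then flframing a
                 else (crossing_sum (flword L) (@flcomp L) a b %/ 2)%Z.

Lemma unknot_compP (i j : 'I_1) :
  ((ord0 : 'I_1) == ord0) = (j \in porbit (braid_perm (nil : seq (letter 0))) i).
Proof. by rewrite (ord1 i) (ord1 j) porbit_id. Qed.

Lemma unknot_comp_surj (a : 'I_1) : exists i : 'I_1, (ord0 : 'I_1) = a.
Proof. by exists ord0; rewrite (ord1 a). Qed.

Definition unknot (f : int) : framed_link :=
  @FramedLink 0 [::] 1 (fun=> ord0) (fun=> f) unknot_compP unknot_comp_surj.

(** * The Seifert manifolds X(p_1/1, ..., p_n/1)

   They are given by their integral surgery presentation.  In the pure braid
   s_0 s_1 ... s_(n-1) s_(n-1) ... s_1 s_0 the strand 0 goes once around the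
   strands 1, ..., n, which stay parallel.  After closure, strands 1, ..., n
   become n unlinked parallel meridians of the unknot formed by strand 0. *)

Definition seifert_word (n : nat) : seq (letter n) :=
  let u := [seq (p, true) | p <- enum 'I_n] in u ++ rev u.

Lemma braid_perm_seifert_word n : braid_perm (seifert_word n) = 1%g.
Proof.
rewrite /seifert_word /=; elim: [seq _ | p <- _] => [|g u IHu].
  by rewrite /braid_perm big_nil.
rewrite /braid_perm rev_cons -cats1 cat_cons catA big_cons big_cat.
by rewrite big_seq1 /= [X in (_ * (X * _))%g]IHu mul1g tperm2.
Qed.

Lemma seifert_compP n (i j : 'I_n.+1) :
  (i == j) = (j \in porbit (braid_perm (seifert_word n)) i).
Proof.
rewrite braid_perm_seifert_word; apply/eqP/porbitP => [->|[k ->]].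
  by exists 0%N; rewrite expg0 perm1.
by rewrite expg1n perm1.
Qed.

Definition seifert (p : seq int) : framed_link :=
  @FramedLink (size p) (seifert_word (size p)) (size p).+1 id
    (fun a => nth 0 (0 :: p) a)
    (@seifert_compP (size p)) (fun a => ex_intro _ a erefl).

(* X_tref(0) *)
Definition Xtref0 : framed_link := seifert [:: -2; 3; 6].

Section Invariants.

Variable R : realType.
Local Notation C := R[i].

(* e^(i x) *)
Definition cis (x : R) : C := Complex (cos x) (sin x).

(* Eigenvalues with multiplicity; in the order of R[i], [0 < z] says that z is
   a positive real. *)
Definition eigenvalues n (A : 'M[int]_n) : seq C :=
  sval (closed_field_poly_normal (char_poly (map_mx intr A : 'M[C]_n))).
Definition bpos (L : framed_link) : nat :=
  count (fun z : C => 0 < z) (eigenvalues (linking_matrix L)).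
Definition bneg (L : framed_link) : nat :=
  count (fun z : C => z < 0) (eigenvalues (linking_matrix L)).

Variable r : nat.

Definition qs : C := cis (pi / r%:R).
Definition qt : C := cis (pi / (2 * r%:R)).
Definition qint (k : nat) : C := (qs ^+ k - qs ^- k) / (qs - qs^-1).
Definition qfact (n : nat) : C := \prod_(1 <= j < n.+1) qint j.

(** * The irreducible representations V_k (0 < k < r) of quantum sl_2

   Generators E, F, K = s^H with K E K^-1 = s^2 E, K F K^-1 = s^-2 F and
   E F - F E = (K - K^-1) / (s - s^-1).  On the basis e_0, ..., e_(k-1) of V_k,
   H e_a = (k-1-2a) e_a, E e_a = [k-a] e_(a-1), F e_a = [a+1] e_(a+1).
   Matrices act on column vectors. *)

Definition wt (k a : nat) : int := k%:Z - 1 - 2 * a%:Z.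
Definition repE (k : nat) : 'M[C]_k :=
  \matrix_(a, b) if a.+1 == b :> nat then qint (k - b) else 0.
Definition repF (k : nat) : 'M[C]_k :=
  \matrix_(a, b) if a == b.+1 :> nat then qint a else 0.

(* The action of the universal R-matrix
     s^(H (x) H / 2)
       \sum_n s^(n(n-1)/2) (s - s^-1)^n / [n]! E^n (x) F^n
   on V_k (x) V_l; note that s^(1/2) = t. *)
Definition Rmx (k l : nat) : 'M[C]_(k * l) :=
  diag_mx (\row_i (let: (a, b) := mxtens_unindex i in qt ^ (wt k a * wt l b)))
  *m \sum_(n < r) (qs ^+ 'C(n, 2) * (qs - qs^-1) ^+ n / qfact n)
                    *: ((repE k ^+ n) *t (repF l ^+ n)).

(* A basis of the direct sum of the V_k, k < r: a color k and an index a < k. *)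
Definition colvec := {k : 'I_r & 'I_k}.

(* Coefficient of e_u' (x) e_v' in A (e_u (x) e_v). *)
Definition mxcoef (A : forall k l : nat, 'M[C]_(k * l)) (u v u' v' : colvec) : C :=
  if (tag u' == tag u) && (tag v' == tag v) then
    A (tag u) (tag v) (mxtens_index (tagged_as u u', tagged_as v v'))
                      (mxtens_index (tagged u, tagged v))
  else 0.

(* The positive crossing acts by flip o R : V_k (x) V_l -> V_l (x) V_k, the
   negative one by the inverse map R^-1 o flip.  [crossing g x y] is the
   coefficient of the basis vector y in the image of x. *)
Definition crossing m (g : letter m) (x y : {ffun 'I_m.+1 -> colvec}) : C :=
  let i := posl g.1 in let j := posr g.1 in
  if [forall h, (h != i) && (h != j) ==> (x h == y h)] then
    if g.2 then mxcoef Rmx (x i) (x j) (y j) (y i)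
    else mxcoef (fun k l => invmx (Rmx k l)) (x j) (x i) (y i) (y j)
  else 0.

Fixpoint braid_coef m (w : seq (letter m)) (x y : {ffun 'I_m.+1 -> colvec}) : C :=
  if w is g :: w' then \sum_z crossing g x z * braid_coef w' z y
  else (x == y)%:R.

(* Framed colored Jones invariant: quantum trace (trace of the action of the
   braid composed with K (x) ... (x) K) on the strands colored by [k], times the
   correction from the blackboard framing of the closed braid to the framing of
   the link, each unit of framing contributing t^(k^2-1). *)
Definition colored_jones (L : framed_link) (k : 'I_(flN L) -> 'I_r) : C :=
  (\prod_a qt ^ ((flframing a - crossing_sum (flword L) (@flcomp L) a a)
                 * ((k a)%:Z ^+ 2 - 1)))
  * \sum_(x : {ffun 'I_(flrank L).+1 -> colvec}
            | [forall i, tag (x i) == k (flcomp i)])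
      (\prod_i qs ^ (wt (tag (x i)) (tagged (x i)))) * braid_coef (flword L) x x.

Definition jones_sum (L : framed_link) : C :=
  \sum_(k : {ffun 'I_(flN L) -> 'I_r} | [forall a, odd (k a)])
    (\prod_a qint (k a)) * colored_jones k.

(* tau'_r of the closed oriented 3-manifold obtained by surgery on L *)
Definition tau' (L : framed_link) : C :=
  (Num.sqrt (4 / r%:R) * sin (pi / r%:R))%:C%C ^+ (flN L - bpos L - bneg L)
  * jones_sum L
  / (jones_sum (unknot 1) ^+ bpos L * jones_sum (unknot (-1)) ^+ bneg L).

End Invariants.

(* Main.v *)
Require Import Defs.
From mathcomp Require Import all_boot all_order all_fingroup all_algebra.
From mathcomp Require Import complex mxtens reals trigo.
From mathcomp Require Import ring lra zify.

Set Implicit Arguments.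
Unset Strict Implicit.
Unset Printing Implicit Defensive.

Import Order.TTheory GRing.Theory Num.Theory.
Local Open Scope ring_scope.

(* The double braiding of V_k and V_l commutes with the coproduct of E, so the
   quantum trace over V_l of its restriction to e_a (x) V_l does not depend on
   a; at the highest weight vector it is [kl]/[k].  Hence J = [k_0] prod_i
   ([k_0 k_i]/[k_0]), and F(L) = sum_k S_(-2)(k) S_3(k) S_6(k) / [k] where
   S_p(k) = sum_j [j] [kj] t^(p(j^2-1)).

   Let y be the r-th root of unity with y^2 = -s.  As k and j are odd,
   replacing s by -s and t by y changes nothing; every summand then depends only
   on j mod r and is even in j, so S_p(k) is half a sum over Z/r, which is computed by
   completing the square.  With {x} = y^(2x) - y^(-2x), and because
   -1/2 + 1/3 + 1/6 = 0, the sum over k becomes, after k = 6x,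
     sum_x {3x} {2x} {x} / {6x} = sum_v (1 - (v^2 + v) / (v^3 + 1)),
   v running over the r-th roots of unity; expanding 1 / (v^3 + 1) as a finite
   geometric series gives 0 or 2r according to r mod 3.  The Gauss sums cancel
   against G_+^2 G_- since <3, 6> and <1, 2> are equivalent quadratic forms over
   Z/r, as are <2, -2> and <1, -1>. *)

(** * The R-matrix *)

Section QuantumIntegers.
Variables (F : fieldType) (s : F).

(** Arguments of either sign are allowed, so that bounds on indices turn into vanishing factors. *)
Definition qz (z : int) : F := (s ^ z - s ^ (- z)) / (s - s^-1).

Lemma qz0 : qz 0 = 0.
Proof. by rewrite /qz oppr0 subrr mul0r. Qed.

(** The factor at [i = - z] is [0]. *)
Lemma prod_qz0 (n : nat) (z : int) :
  - n%:Z < z <= 0 -> \prod_(i < n) qz (z + i%:Z) = 0.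
Proof.
move=> Hz; have Hm : (`|z| < n)%N by lia.
rewrite (bigD1 (Ordinal Hm)) //= (_ : z + _ = 0) ?qz0 ?mul0r //; lia.
Qed.

End QuantumIntegers.

Section RMatrix.
Variables (F : fieldType) (s t : F).
Hypotheses (tt : t * t = s) (t_neq0 : t != 0) (s_neqV : s - s^-1 != 0).
Local Notation "[[ z ]]" := (qz s z) (format "[[ z ]]").

Let s_neq0 : s != 0. Proof. by rewrite -tt mulf_neq0. Qed.

Definition wtz (k a : int) : int := k - 1 - 2 * a.

(* Coefficient of e_(a-n) (x) e_(b+n) in R (e_a (x) e_b), for arbitrary integers
   a and b: outside the range of the indices the quantum integers vanish. *)
Definition rcoef (k l a b : int) (n : nat) : F :=
  t ^ (wtz k (a - n%:Z) * wtz l (b + n%:Z))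
  * (s ^+ 'C(n, 2) * (s - s^-1) ^+ n / \prod_(1 <= j < n.+1) [[j%:Z]])
  * (\prod_(i < n) [[k - a + i%:Z]] * \prod_(i < n) [[b + 1 + i%:Z]]).

Lemma exprz_double (x : int) : t ^ (2 * x) = s ^ x.
Proof. by rewrite -exprz_exp -tt. Qed.

(** With D(E) = E (x) K + 1 (x) E and D'(E) = E (x) 1 + K (x) E, this is the coefficient of
    e_(a-1-m) (x) e_(b+m) in R D(E) = D'(E) R applied to e_a (x) e_b. Passing from [m] to [m.+1]
    brings in the denominator [m+1]. *)
Lemma rcoef_intertwine (k l a b : int) (m : nat) : [[m.+1%:Z]] != 0 ->
  [[k - a]] * s ^ wtz l b * rcoef k l (a - 1) b m
    + [[l - b]] * rcoef k l a (b - 1) m.+1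
  = rcoef k l a b m * [[k - a + m%:Z]]
    + rcoef k l a b m.+1 * s ^ wtz k (a - 1 - m%:Z) * [[l - b - m%:Z - 1]].
Proof.
move=> m_neq0; rewrite /rcoef.
set X := wtz k (a - 1 - m%:Z); set Y := wtz l (b + m%:Z).
pose A := \prod_(i < m) [[k - a + 1 + i%:Z]].
pose B := \prod_(i < m) [[b + 1 + i%:Z]].
have EA : \prod_(i < m.+1) [[k - a + i%:Z]] = [[k - a]] * A.
  rewrite big_ord_recl addr0; congr (_ * _); apply: eq_bigr => i _.
  by congr qz; rewrite lift0; lia.
have EA' : \prod_(i < m) [[k - a + i%:Z]] * [[k - a + m%:Z]] = [[k - a]] * A.
  by rewrite -EA big_ord_recr.
have EA1 : \prod_(i < m) [[k - (a - 1) + i%:Z]] = A.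
  by apply: eq_bigr => i _; congr qz; lia.
have EB : \prod_(i < m.+1) [[b - 1 + 1 + i%:Z]] = [[b]] * B.
  rewrite big_ord_recl addr0 subrK; congr (_ * _); apply: eq_bigr => i _.
  by congr qz; rewrite lift0; lia.
rewrite EA1 EA EB (big_ord_recr m) /= -/B.
rewrite (big_nat_recr m.+1) //= binS bin1 addnC exprD exprS invfM.
have -> : wtz k (a - m.+1%:Z) = X by rewrite /X /wtz; lia.
have -> : wtz l (b - 1 + m.+1%:Z) = Y by rewrite /Y /wtz; lia.
have -> : wtz k (a - m%:Z) * Y = X * Y + 2 * (- Y) by rewrite /X /wtz; ring.
have -> : X * wtz l (b + m.+1%:Z) = X * Y + 2 * (- X).
  by rewrite /Y /wtz intS; ring.
rewrite !(expfzDr _ _ t_neq0) !exprz_double.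
set T := t ^ (X * Y); set S := s ^+ 'C(m, 2); set Z := (s - s^-1) ^+ m.
set Q := (\prod_(1 <= j < _) _)^-1.
have EX : s ^ (- X) * s ^ X = 1 by rewrite -expfzDr // addNr expr0z.
(* Once the common factor is taken out, neither [k] nor [a] remains: this is a rational identity in
   [s], [s ^ m], [s ^ b] and [s ^ l]. *)
suff H : s ^ wtz l b + s ^+ m * (s - s^-1) / [[m.+1%:Z]] * ([[b]] * [[l - b]])
  = s ^ (- Y) + s ^+ m * (s - s^-1) / [[m.+1%:Z]] *
       ([[b + 1 + m%:Z]] * [[l - b - m%:Z - 1]]).
  transitivity (T * S * Z * Q * [[k - a]] * A * B *
     (s ^ wtz l b + s ^+ m * (s - s^-1) / [[m.+1%:Z]] * ([[b]] * [[l - b]]))).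
    by ring.
  rewrite H.
  transitivity (T * s ^ (- Y) * (S * Z * Q) *
     (\prod_(i < m) [[k - a + i%:Z]] * [[k - a + m%:Z]]) * B
     + T * (s ^ (- X) * s ^ X) * ([[k - a]] * A) * (S * Z * Q) * B * 
      (s ^+ m * (s - s^-1) / [[m.+1%:Z]] *
       ([[b + 1 + m%:Z]] * [[l - b - m%:Z - 1]]))).
    by rewrite EA' EX; ring.
  by ring.
have {T S Z Q A B EA EA' EA1 EB} sN0 x : s ^ x != 0 by rewrite expfz_neq0.
have DN x : s ^ (- x) = (s ^ x)^-1 by rewrite invr_expz.
move: m_neq0; rewrite /qz mulf_eq0 negb_or => /andP[Hm _].
rewrite /Y /wtz !mulr_natl !mulr2n intS in Hm *.
rewrite !opprD !opprK !(expfzDr _ _ s_neq0) ?DN ?expr1z in Hm *.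
rewrite -[s ^+ m]/(s ^ m).
have := sN0 m; have := sN0 b; have := sN0 l.
move: (s ^ m) (s ^ b) (s ^ l) Hm => u v w Hm w0 v0 u0.
have s2 : s * s - 1 != 0.
  by rewrite -(mulfV s_neq0) -mulrBr mulf_neq0.
have su2 : s * u * (s * u) - 1 != 0.
  have su0 : s * u != 0 by rewrite mulf_neq0.
  by rewrite -(mulfV su0) -mulrBr mulf_neq0 // invfM.
by field; rewrite s_neq0 s2 w0 u0 v0 su2.
Qed.

(** Here [a - n < k <= a], so the product coming from E^n passes through [0]. *)
Lemma rcoef_eq0l (k l a b : int) (n : nat) :
  - n%:Z < k - a <= 0 -> rcoef k l a b n = 0.
Proof. by move=> H; rewrite /rcoef prod_qz0 ?mul0r ?mulr0. Qed.

(** Here [b < 0 <= b + n], so the product coming from F^n passes through [0]. *)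
Lemma rcoef_eq0r (k l a b : int) (n : nat) :
  - n%:Z < b + 1 <= 0 -> rcoef k l a b n = 0.
Proof. by move=> H; rewrite /rcoef (prod_qz0 _ H) !mulr0. Qed.

Lemma rcoef0 (k l a b : int) : rcoef k l a b 0 = t ^ (wtz k a * wtz l b).
Proof.
rewrite /rcoef !big_ord0 big_nil !expr0 divr1 !mulr1; congr (t ^ (_ * _)).
  by rewrite subr0.
by rewrite addr0.
Qed.

(* Diagonal coefficient at e_a (x) e_b of the double braiding of V_k and V_l. *)
Definition double_coef (N : nat) (k l a b : int) : F :=
  \sum_(n < N) rcoef k l a b n * rcoef l k (b + n%:Z) (a - n%:Z) n.

Variable M : nat.
Hypothesis qzM : forall m : nat, (0 < m <= M)%N -> [[m%:Z]] != 0.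

(* The first [M] terms of the coefficient of e_(a-1) (x) e_(b+1) in the image of
   e_a (x) e_b under the double braiding. *)
Let offdiag (k l a b : int) : F :=
  \sum_(n < M) rcoef k l a b n.+1 * rcoef l k (b + n.+1%:Z) (a - n.+1%:Z) n.

(** In the term [n = M] the second crossing raises the negative index [a - 1 - M] to [a - 1 >= 0],
    so [rcoef_eq0r] applies. *)
Lemma double_coef_recr (k l a b : int) : 0 < a <= M%:Z ->
  double_coef M.+1 k l (a - 1) b = double_coef M k l (a - 1) b.
Proof.
move=> Ha; rewrite /double_coef big_ord_recr /=.
by rewrite [X in _ * X]rcoef_eq0r ?mulr0 ?addr0 //; lia.
Qed.

(* The double braiding commutes with E (x) K + 1 (x) E. *)
Lemma double_coef_step (k l a b : int) : 0 < a <= M%:Z ->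
  [[k - a]] * s ^ wtz l b * double_coef M.+1 k l a b
    + [[l - b - 1]] * offdiag k l a b
  = [[k - a]] * s ^ wtz l b * double_coef M.+1 k l (a - 1) b
    + [[l - b]] * offdiag k l a (b - 1).
Proof.
move=> Ha; rewrite double_coef_recr //.
(* [S] is the coefficient of e_(a-1) (x) e_b when E acts between the two crossings. The intertwining
   relation of the first crossing equates it to the right-hand side, that of the second crossing to
   the left-hand side. *)
pose S := \sum_(n < M) (rcoef k l a b n * [[k - a + n%:Z]]
  + rcoef k l a b n.+1 * s ^ wtz k (a - 1 - n%:Z) * [[l - b - n%:Z - 1]])
  * rcoef l k (b + n%:Z) (a - 1 - n%:Z) n.
transitivity S; last first.
  rewrite /double_coef /offdiag !mulr_sumr -big_split; apply: eq_bigr => n _ /=.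
  rewrite -rcoef_intertwine; last by apply: qzM; case: n.
  rewrite (_ : b - 1 + n.+1%:Z = b + n%:Z); last by lia.
  rewrite (_ : a - n.+1%:Z = a - 1 - n%:Z); last by lia.
  by ring.
have -> : S = \sum_(n < M.+1) rcoef k l a b n * [[k - a + n%:Z]]
        * rcoef l k (b + n%:Z) (a - 1 - n%:Z) n
   + \sum_(n < M) rcoef k l a b n.+1 * s ^ wtz k (a - 1 - n%:Z)
        * [[l - b - n%:Z - 1]] * rcoef l k (b + n%:Z) (a - 1 - n%:Z) n.
  rewrite big_ord_recr /= [X in _ + _ * X + _]rcoef_eq0r; last by lia.
  rewrite mulr0 addr0 -big_split; apply: eq_bigr => n _ /=; ring.
rewrite /double_coef /offdiag !mulr_sumr !big_ord_recl /=.
rewrite -!addrA -!big_split; congr (_ + _).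
  have E : wtz l b * wtz k (a - 1) = wtz l b * wtz k a + 2 * wtz l b.
    by rewrite /wtz; ring.
  rewrite !rcoef0 /= !addr0 E (expfzDr _ _ t_neq0) exprz_double.
  by ring.
apply: eq_bigr => n _ /=; rewrite /bump add1n.
pose a' := a - n.+1%:Z; pose b' := b + n.+1%:Z.
have := @rcoef_intertwine l k b' a' n (qzM _); rewrite ltn_ord => /(_ isT).
have [Ea Eb] : a - 1 - n%:Z = a' /\ b + n%:Z = b' - 1 by rewrite /a' /b'; lia.
have [Ec Ed] : k - a + n.+1%:Z = k - a' /\ a - 1 - n.+1%:Z = a' - 1.
  by rewrite /a'; lia.
have [Ee Ef] : l - b - n%:Z - 1 = l - b' /\ l + (- b - 1) = l - b' + n%:Z.
  by rewrite /b'; lia.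
have [Eg Eh] : b' - 1 - n%:Z = b /\ k - a' - n%:Z - 1 = k - a.
  by rewrite /a' /b'; lia.
rewrite Ea Eb Ec Ed Ee Ef Eg Eh -/a' -/b' => H.
rewrite -[RHS](_ : rcoef k l a b n.+1 *
    ([[l - b']] * s ^ wtz k a' * rcoef l k (b' - 1) a' n +
     [[k - a']] * rcoef l k b' (a' - 1) n.+1) = _); first by rewrite H; ring.
by ring.
Qed.

(** E kills the highest weight vector, so only [n = 0] contributes, with the same power of [t] at
    both crossings. *)
Lemma double_coef0 (k l b : int) :
  double_coef M.+1 k l 0 b = s ^ ((k - 1) * wtz l b).
Proof.
rewrite /double_coef big_ord_recl big1 ?addr0 => [|n _]; last first.
  by rewrite [X in _ * X]rcoef_eq0r ?mulr0 //= /bump; lia.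
rewrite !rcoef0 /= -expfzDr // -exprz_double ?addr0 ?subr0; congr (t ^ _).
by rewrite /wtz; ring.
Qed.

(** Summed over [b], the off-diagonal terms of [double_coef_step] telescope, which makes the traces
    at [a] and [a.+1] equal; the one at [a = 0] is read off [double_coef0]. *)
Lemma quantum_trace_double (k l a : nat) : (a < k <= M)%N ->
  \sum_(b < l) s ^ wtz l b * double_coef M.+1 k l a b
  = \sum_(b < l) s ^ (k%:Z * wtz l b).
Proof.
move=> Ha; elim: a Ha => [|a IHa] Ha.
  apply: eq_bigr => b _; rewrite double_coef0 -expfzDr //; congr (s ^ _).
  by ring.
rewrite -IHa; last by lia.
have ka0 : [[k%:Z - a.+1%:Z]] != 0.
  by rewrite (_ : _ - _ = (k - a.+1)%N%:Z) ?qzM //; lia.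
pose f (b : nat) := - ([[l%:Z - b%:Z]] * offdiag k l a.+1 (b%:Z - 1)).
apply/(mulfI ka0)/eqP; rewrite -subr_eq0 !mulr_sumr -sumrB.
rewrite (eq_bigr (fun b : 'I_l => f b.+1 - f b)) => [|b _]; last first.
  have := @double_coef_step k l a.+1 b%:Z ltac:(lia).
  rewrite /f (_ : a.+1%:Z - 1 = a); last by lia.
  rewrite (_ : b.+1%:Z - 1 = b%:Z); last by lia.
  rewrite (_ : l%:Z - b%:Z - 1 = l%:Z - b.+1%:Z); last by lia.
  rewrite -!mulrA !opprK => /(canRL (addrK _)) ->.
  by ring.
rewrite -(big_mkord predT (fun b => f b.+1 - f b)) telescope_sumr //.
(* Both ends vanish: at [b = l] because of the factor [0], at [b = 0] because [offdiag] is then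
   taken at the index -1. *)
rewrite /f subrr qz0 mul0r opprK oppr0 add0r /offdiag big1 ?mulr0 // => n _.
by rewrite rcoef_eq0r ?mul0r //; lia.
Qed.

(** Multiplying this geometric series by [s ^+ k - s ^- k] makes it telescope. *)
Lemma sum_weights (k l : nat) : s ^+ k - s ^- k != 0 ->
  \sum_(b < l) s ^ (k%:Z * wtz l b) = [[(k * l)%N%:Z]] / [[k%:Z]].
Proof.
move=> k0; pose f (b : nat) := - s ^ (k%:Z * (l%:Z - 2 * b%:Z)).
have [Ek sk] : s ^+ k = s ^ k%:Z /\ s ^- k = s ^ (- k%:Z) by rewrite exprnN.
rewrite /qz -sk invf_div mulrA divfK //.
apply: (canRL (mulfK k0)); rewrite mulr_suml.
rewrite (eq_bigr (fun b : 'I_l => f b.+1 - f b)) => [|b _]; last first.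
  rewrite Ek sk mulrBr -!expfzDr // /f opprK addrC.
  by congr (- s ^ _ + s ^ _); rewrite /wtz ?intS; ring.
rewrite -(big_mkord predT (fun b => f b.+1 - f b)) telescope_sumr //.
rewrite /f opprK addrC subr0 PoszM.
by congr (s ^ _ - s ^ _); ring.
Qed.

End RMatrix.

(** * Quantum integers at a root of unity *)

Section RootsOfUnity.
Variable R : realType.
Implicit Types x y : R.

Lemma cisD x y : cis (x + y) = cis x * cis y.
Proof. by rewrite /cis cosD sinD; simpc; congr Complex; ring. Qed.

Lemma cis0 : cis (0 : R) = 1.
Proof. by rewrite /cis cos0 sin0. Qed.

Lemma cis_neq0 x : cis x != 0.
Proof.
apply/eqP => H; have := cisD x (- x).
by rewrite subrr cis0 H mul0r => /eqP; rewrite oner_eq0.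
Qed.

Lemma cisN x : cis (- x) = (cis x)^-1.
Proof.
by apply: (mulfI (cis_neq0 x)); rewrite -cisD subrr cis0 divff ?cis_neq0.
Qed.

Lemma cisX x n : cis x ^+ n = cis (n%:R * x).
Proof.
elim: n => [|n IHn]; first by rewrite mul0r cis0.
by rewrite exprS IHn -cisD -natr1 mulrDl mul1r addrC.
Qed.

Lemma cis_sub_inv x : cis x - (cis x)^-1 = Complex 0 (2 * sin x).
Proof.
by rewrite -cisN /cis cosN sinN; simpc; congr Complex; ring.
Qed.

Variable r : nat.
Hypothesis r_gt1 : (1 < r)%N.
Local Notation s := (qs R r).
Local Notation t := (qt R r).

Let r0 : r%:R != 0 :> R. Proof. by rewrite pnatr_eq0; lia. Qed.

Lemma qt_sqr : t * t = s.
Proof. by rewrite /qt -cisD /qs; congr cis; field. Qed.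

Lemma qt_neq0 : t != 0. Proof. exact: cis_neq0. Qed.
Lemma qs_neq0 : s != 0. Proof. exact: cis_neq0. Qed.

(** The difference is 2i sin(k pi / r), and k pi / r lies strictly between 0 and pi. *)
Lemma qsX_subV_neq0 k : (0 < k < r)%N -> s ^+ k - s ^- k != 0.
Proof.
move=> Hk; rewrite cisX cis_sub_inv eq_complex /= negb_and orbC mulf_neq0 //.
  by rewrite pnatr_eq0.
have rp : 0 < r%:R :> R by rewrite ltr0n; lia.
have kp : 0 < k%:R :> R by rewrite ltr0n; lia.
rewrite gt_eqF // sin_gt0_pi // mulr_gt0 ?divr_gt0 ?pi_gt0 //=.
by rewrite mulrCA gtr_pMr ?pi_gt0 // ltr_pdivrMr // mul1r ltr_nat; lia.
Qed.

Lemma qs_subV_neq0 : s - s^-1 != 0.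
Proof. by rewrite (@qsX_subV_neq0 1). Qed.

Lemma qint_qz k : qint R r k = qz s k.
Proof. by rewrite /qint /qz exprnN. Qed.

Lemma qint_neq0 k : (0 < k < r)%N -> qint R r k != 0.
Proof.
by move=> Hk; rewrite mulf_neq0 ?invr_eq0 ?qsX_subV_neq0 ?qs_subV_neq0.
Qed.

Lemma qsX_r : s ^+ r = -1.
Proof.
rewrite cisX mulrCA divff // mulr1 /cis cospi sinpi.
by apply/eqP; rewrite eq_complex /= oppr0 !eqxx.
Qed.

End RootsOfUnity.

(** * Entries of the R-matrix *)

Section RMatrixEntries.
Variables (R : realType) (r : nat).
Local Notation s := (qs R r).
Local Notation t := (qt R r).
Local Notation rc := (rcoef s t).

Lemma repE_expE k n (a' a : 'I_k) :
  (repE R r k ^+ n) a' a =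
  if (a' + n == a)%N then \prod_(i < n) qz s (k%:Z - a%:Z + i%:Z) else 0.
Proof.
elim: n a' => [|n IHn] a'.
  by rewrite expr0 mxE addn0 big_ord0 -val_eqE /=; case: eqP.
rewrite exprS mxE addnS.
case: eqP => [Ha|Ha].
  have Hc : (a'.+1 < k)%N by have := ltn_ord a; lia.
  rewrite (bigD1 (Ordinal Hc)) //= big1 => [|c Hne].
    rewrite IHn /= addSn Ha eqxx addr0 big_ord_recr /= mulrC mxE eqxx.
    rewrite qint_qz; congr (_ * qz _ _); by have := ltn_ord a; move: Ha => /=; lia.
  rewrite mxE; case: eqP => [E|]; last by rewrite mul0r.
  by case/eqP: Hne; apply: val_inj.
rewrite big1 // => c _; rewrite mxE; case: eqP => [E|]; last by rewrite mul0r.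
by rewrite IHn -E addSn; case: eqP => // _; rewrite mulr0.
Qed.

Lemma repF_expE k n (b' b : 'I_k) :
  (repF R r k ^+ n) b' b =
  if (b' == b + n :> nat)%N then \prod_(i < n) qz s (b%:Z + 1 + i%:Z) else 0.
Proof.
elim: n b' => [|n IHn] b'.
  by rewrite expr0 mxE addn0 big_ord0 -val_eqE /=; case: eqP.
rewrite exprS mxE addnS.
case: eqP => [Hb|Hb].
  have Hc : (b + n < k)%N by have := ltn_ord b'; lia.
  rewrite (bigD1 (Ordinal Hc)) //= big1 => [|c Hne].
    rewrite IHn /= eqxx addr0 big_ord_recr /= mulrC mxE Hb eqxx.
    by rewrite qint_qz; congr (_ * qz _ _); lia.
  rewrite mxE; case: eqP => [E|]; last by rewrite mul0r.
  by case/eqP: Hne; apply: val_inj => /=; lia.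
rewrite big1 // => c _; rewrite mxE; case: eqP => [E|]; last by rewrite mul0r.
by rewrite IHn; case: eqP => [E'|]; rewrite ?mulr0 //; lia.
Qed.

Lemma RmxE k l (a' a : 'I_k) (b' b : 'I_l) :
  Rmx R r k l (mxtens_index (a', b')) (mxtens_index (a, b)) =
  \sum_(n < r) if (a' + n == a)%N && (b' == b + n :> nat)%N
               then rc k l a b n else 0.
Proof.
rewrite /Rmx mul_diag_mx mxE mxE mxtens_indexK summxE mulr_sumr.
apply: eq_bigr => n _; rewrite mxE tensmxE repE_expE repF_expE.
case: eqP => [Ea|]; last by rewrite mul0r !mulr0.
case: eqP => [Eb|]; last by rewrite !mulr0.
rewrite /rcoef mulrA /qfact; congr (_ ^ (_ * _) * (_ / _) * _).
- by rewrite /wt /wtz; lia.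
- by rewrite /wt /wtz; lia.
- by apply: eq_bigr => j _; rewrite qint_qz.
Qed.

End RMatrixEntries.

(** * Partial trace of the double braiding *)

Section PartialTrace.
Variables (R : realType) (r : nat).
Hypothesis r_gt1 : (1 < r)%N.
Local Notation C := R[i].
Local Notation s := (qs R r).
Local Notation t := (qt R r).
Local Notation rc := (rcoef s t).
Local Notation Rm k l p q := (Rmx R r k l (mxtens_index p) (mxtens_index q)).

(** If the first crossing leaves the index range, the coefficient of the way back vanishes. Hence
    [double_coef], which ignores the range, agrees with the matrix product. *)
Lemma rcoefS_eq0 (k l a b : nat) n : (a < n)%N || (l <= b + n)%N && (b < l)%N ->
  rc l k (b%:Z + n%:Z) (a%:Z - n%:Z) n = 0.
Proof.
case/orP => H; first by apply: rcoef_eq0r; lia.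
by apply: rcoef_eq0l; lia.
Qed.

(** Each crossing shifts the two indices by opposite amounts, so if [b] returns to itself then so
    does [a]. For each [n] the only intermediate pair is [(a - n, b + n)]. *)
Lemma double_braiding k l (a a' : 'I_k) (b : 'I_l) : (k < r)%N ->
  \sum_(p : 'I_k * 'I_l) Rm k l p (a, b) * Rm l k (b, a') (p.2, p.1)
  = (a == a')%:R * double_coef s t r k l a b.
Proof.
move=> k_lt_r.
transitivity (\sum_(n < r) \sum_(p : 'I_k * 'I_l)
    if (p.1 + n == a)%N && (p.2 == b + n :> nat)%N
    then rc k l a b n * Rm l k (b, a') (p.2, p.1) else 0).
  rewrite exchange_big /=; apply: eq_bigr => -[a1 b1] _.
  rewrite RmxE mulr_suml; apply: eq_bigr => n _ /=.
  by case: ifP; rewrite ?mul0r.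
rewrite /double_coef mulr_sumr; apply: eq_bigr => n _.
have [Hn|Hn] := boolP ((n <= a) && (b + n < l))%N; last first.
  rewrite rcoefS_eq0 ?mulr0; last by have := ltn_ord b; lia.
  rewrite big1 // => -[a1 b1] _; case: ifP => //= /andP[/eqP Ea /eqP Eb].
  by have := ltn_ord b1; lia.
have [Ha Hb] : (a - n < k)%N /\ (b + n < l)%N by have := ltn_ord a; lia.
rewrite (bigD1 (Ordinal Ha, Ordinal Hb)) //= big1 ?addr0 => [|[a1 b1] Hne].
  rewrite eqxx subnK ?eqxx /=; last by lia.
  rewrite mulrCA; congr (_ * _).
  rewrite RmxE (bigD1 n) //= eqxx /= big1 ?addr0 => [|m Hm].
    rewrite subnK; last by lia.
    rewrite -val_eqE eq_sym; case: eqP => _; rewrite (mul1r, mul0r) //.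
    by congr rcoef; lia.
  by case: eqP => //= H; case/eqP: Hm; apply: val_inj => /=; lia.
case: eqP => //= Ea; case: eqP => //= Eb.
by case/eqP: Hne; congr pair; apply: val_inj => /=; lia.
Qed.

(* The strand colored l, closed up around a strand colored k, acts on V_k as a
   scalar. *)
Lemma partial_trace (k l : nat) (a : 'I_k) (h : 'I_k -> C) :
  (0 < k < r)%N ->
  \sum_(b < l) s ^ wt l b * (\sum_(p : 'I_k * 'I_l) Rm k l p (a, b) *
     (\sum_(q : 'I_l * 'I_k) Rm l k q (p.2, p.1) * ((q.1 == b)%:R * h q.2)))
  = qint R r (k * l) / qint R r k * h a.
Proof.
move=> k_lt_r.
have [[tt t0] sV] := (qt_sqr R r_gt1, qt_neq0 R r, qs_subV_neq0 R r_gt1).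
(* This is the hypothesis of [quantum_trace_double] for [M = r.-1]; its sums then have the [r] terms
   of the R-matrix. *)
have qz0 m : (0 < m <= r.-1)%N -> qz s m != 0.
  by move=> Hm; rewrite -qint_qz qint_neq0 //; lia.
rewrite !qint_qz -(sum_weights tt t0 sV) ?qsX_subV_neq0 //.
rewrite -(@quantum_trace_double _ s t tt t0 sV r.-1 qz0 k l a); last first.
  by have := ltn_ord a; lia.
rewrite prednK; last by lia.
rewrite mulr_suml; apply: eq_bigr => b _; rewrite -mulrA; congr (_ * _).
transitivity (\sum_(a' < k) (a == a')%:R * double_coef s t r k l a b * h a').
  under [RHS]eq_bigr => a' _ do
    (rewrite -double_braiding ?mulr_suml; last by lia).
  rewrite exchange_big; apply: eq_bigr => p _ /=.
  under [RHS]eq_bigr => a' _ do rewrite -mulrA.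
  rewrite -mulr_sumr; congr (_ * _).
  rewrite (eq_bigr (fun q => Rm l k (q.1, q.2) (p.2, p.1) *
    ((q.1 == b)%:R * h q.2))); last by case.
  rewrite -(pair_bigA _ (fun b' a' => Rm l k (b', a') (p.2, p.1) *
    ((b' == b)%:R * h a'))) (bigD1 b) //= [X in _ + X]big1 ?addr0.
    by apply: eq_bigr => a' _; rewrite eqxx mul1r.
  move=> b' /negPf Hb; rewrite big1 // => a' _.
  by rewrite Hb mul0r mulr0.
rewrite (bigD1 a) //= eqxx mul1r big1 ?addr0 // => a' Ha.
by rewrite eq_sym (negPf Ha) !mul0r.
Qed.

End PartialTrace.

(** * The colored Jones invariant of the Seifert link *)

Section FourTuples.
Variable T : Type.

Definition ffun4 (a b c d : T) : {ffun 'I_4 -> T} :=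
  [ffun i : 'I_4 => nth a [:: a; b; c; d] i].

Lemma ffun4_eta (x : {ffun 'I_4 -> T}) :
  x = ffun4 (x 0) (x 1) (x 2) (x 3).
Proof.
apply/ffunP => -[[|[|[|[|//]]]] i]; rewrite ffunE /=;
  by congr (x _); apply: val_inj.
Qed.

End FourTuples.

Lemma big_ffun4 (V : nmodType) (T : finType) (P : 'I_4 -> pred T)
    (f : {ffun 'I_4 -> T} -> V) :
  \sum_(x : {ffun 'I_4 -> T} | [forall i, P i (x i)]) f x =
  \sum_(a | P 0 a) \sum_(b | P 1 b) \sum_(c | P 2 c) \sum_(d | P 3 d)
     f (ffun4 a b c d).
Proof.
transitivity (\sum_(a | P 0 a) \sum_(q | [&& P 1 q.1, P 2 q.2.1 & P 3 q.2.2])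
    f (ffun4 a q.1 q.2.1 q.2.2)); last first.
  apply: eq_bigr => a _; rewrite -(pair_big (P 1) (fun q => P 2 q.1 && P 3 q.2)
    (fun b q => f (ffun4 a b q.1 q.2))).
  apply: eq_bigr => b _.
  by rewrite -(pair_big (P 2) (P 3) (fun c d => f (ffun4 a b c d))).
rewrite (pair_big (P 0) (fun q => [&& P 1 q.1, P 2 q.2.1 & P 3 q.2.2])
  (fun a q => f (ffun4 a q.1 q.2.1 q.2.2))).
rewrite (reindex (fun p => ffun4 p.1 p.2.1 p.2.2.1 p.2.2.2)) /=.
  apply: eq_bigl => -[a [b [c d]]] /=; apply/forallP/and4P => [H|[Ha Hb Hc Hd]].
    by split; [have := H 0|have := H 1|have := H 2|have := H 3]; rewrite ffunE.
  move=> [[|[|[|[|//]]]] i]; rewrite ffunE /=;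
    [apply: etrans Ha|apply: etrans Hb|apply: etrans Hc|apply: etrans Hd];
    by congr (P _ _); apply: val_inj.
exists (fun x : {ffun 'I_4 -> T} => (x 0, (x 1, (x 2, x 3)))) => [[a [b [c d]]]|x] _.
  by rewrite /= !ffunE.
by rewrite /= -ffun4_eta.
Qed.

(** * Action of the Seifert braid *)

Section Braids.
Variables (R : realType) (r : nat).
Local Notation C := R[i].
Local Notation s := (qs R r).
Local Notation t := (qt R r).
Local Notation V := (colvec r).
Local Notation Rm k l p q := (Rmx R r k l (mxtens_index p) (mxtens_index q)).

Definition bvec (k : 'I_r) (a : 'I_k) : V := Tagged (fun k : 'I_r => 'I_k) a.

Lemma sum_tag (k : 'I_r) (g : V -> C) :
  \sum_(u | tag u == k) g u = \sum_(a < k) g (bvec a).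
Proof.
rewrite (eq_bigr (fun u : V => g (bvec (tagged u)))); last by case.
rewrite (eq_bigl (fun u : V => (tag u == k) && true)); last first.
  by move=> u; rewrite andbT.
rewrite -(sig_big_dep (fun i => i == k) (fun _ _ => true)
   (fun i (a : 'I_i) => g (bvec a))).
by rewrite big_pred1_eq.
Qed.

Lemma sum_mxcoef (A : forall k l : nat, 'M[C]_(k * l)) (k l : 'I_r)
    (a : 'I_k) (b : 'I_l) (f : V -> V -> C) :
  \sum_u \sum_v mxcoef A (bvec a) (bvec b) u v * f u v =
  \sum_(p : 'I_k * 'I_l) A k l (mxtens_index p) (mxtens_index (a, b))
     * f (bvec p.1) (bvec p.2).
Proof.
rewrite (bigID (fun u : V => tag u == k)) /= [X in _ + X]big1 ?addr0; last first.
  by move=> u /negPf Hu; rewrite big1 // => v _; rewrite /mxcoef /= Hu mul0r.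
rewrite sum_tag [RHS](eq_bigr (fun p : 'I_k * 'I_l =>
   A k l (mxtens_index (p.1, p.2)) (mxtens_index (a, b))
     * f (bvec p.1) (bvec p.2))); last by case.
rewrite -(pair_bigA _ (fun a' b' => A k l (mxtens_index (a', b'))
  (mxtens_index (a, b)) * f (bvec a') (bvec b'))) /=.
apply: eq_bigr => a' _.
rewrite (bigID (fun u : V => tag u == l)) /= [X in _ + X]big1 ?addr0; last first.
  by move=> u /negPf Hu; rewrite /mxcoef /= Hu andbF mul0r.
by rewrite sum_tag; apply: eq_bigr => b' _; rewrite /mxcoef /= !eqxx /= !tagged_asE.
Qed.

(** The flip that follows R puts the vector [v] of the second factor on the left. *)
Definition swap_at m (p : 'I_m) (x : {ffun 'I_m.+1 -> V}) (v u : V) :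
    {ffun 'I_m.+1 -> V} :=
  [ffun h => if h == posl p then v else if h == posr p then u else x h].

Lemma posl_neq_posr m (p : 'I_m) : posl p != posr p.
Proof. by rewrite -val_eqE /= /bump add1n; apply/eqP; lia. Qed.

Lemma sum_crossing m (p : 'I_m) x (f : {ffun 'I_m.+1 -> V} -> C) :
  \sum_z crossing R (p, true) x z * f z =
  \sum_u \sum_v mxcoef (Rmx R r) (x (posl p)) (x (posr p)) u v
     * f (swap_at p x v u).
Proof.
rewrite pair_bigA /= (bigID (fun z : {ffun _} =>
  [forall h, (h != posl p) && (h != posr p) ==> (x h == z h)])) /=.
rewrite [X in _ + X]big1 ?addr0; last first.
  by move=> z /negPf H; rewrite /crossing H mul0r.
have lr := negPf (posl_neq_posr p).
rewrite (reindex_onto (fun q => swap_at p x q.2 q.1)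
   (fun z => (z (posr p), z (posl p)))) /=; last first.
  move=> z /forallP H; apply/ffunP => h; rewrite ffunE.
  case: eqP => [->//|/eqP Hl]; case: eqP => [->//|/eqP Hr].
  by apply/eqP; have := H h; rewrite Hl Hr.
apply: eq_big => [[u v]|[u v]] /=.
  rewrite !ffunE eqxx [posr p == _]eq_sym lr !eqxx andbT; apply/forallP => h.
  by apply/implyP => /andP[/negPf Hl /negPf Hr]; rewrite ffunE Hl Hr.
rewrite /crossing /= => /andP[-> _].
by rewrite !ffunE eqxx [posr p == _]eq_sym lr !eqxx.
Qed.

Lemma swap_at_ffun4 (a b c d u v : V) :
  [/\ swap_at (0 : 'I_3) (ffun4 a b c d) v u = ffun4 v u c d,
      swap_at (1 : 'I_3) (ffun4 a b c d) v u = ffun4 a v u d &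
      swap_at (2 : 'I_3) (ffun4 a b c d) v u = ffun4 a b v u].
Proof.
by split; apply/ffunP => -[[|[|[|[|//]]]] i]; rewrite !ffunE.
Qed.

Lemma braid_coef0 w (k l : 'I_r) (a : 'I_k) (b : 'I_l) c d y :
  braid_coef R ((0 : 'I_3, true) :: w) (ffun4 (bvec a) (bvec b) c d) y =
  \sum_(p : 'I_k * 'I_l) Rm k l p (a, b)
    * braid_coef R w (ffun4 (bvec p.2) (bvec p.1) c d) y.
Proof.
rewrite /= sum_crossing !ffunE /= sum_mxcoef; apply: eq_bigr => p _.
by have [-> _ _] := swap_at_ffun4 (bvec a) (bvec b) c d (bvec p.1) (bvec p.2).
Qed.

Lemma braid_coef1 w (k l : 'I_r) (a : 'I_k) (b : 'I_l) c d y :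
  braid_coef R ((1 : 'I_3, true) :: w) (ffun4 c (bvec a) (bvec b) d) y =
  \sum_(p : 'I_k * 'I_l) Rm k l p (a, b)
    * braid_coef R w (ffun4 c (bvec p.2) (bvec p.1) d) y.
Proof.
rewrite /= sum_crossing !ffunE /= sum_mxcoef; apply: eq_bigr => p _.
by have [_ -> _] := swap_at_ffun4 c (bvec a) (bvec b) d (bvec p.1) (bvec p.2).
Qed.

Lemma braid_coef2 w (k l : 'I_r) (a : 'I_k) (b : 'I_l) c d y :
  braid_coef R ((2 : 'I_3, true) :: w) (ffun4 c d (bvec a) (bvec b)) y =
  \sum_(p : 'I_k * 'I_l) Rm k l p (a, b)
    * braid_coef R w (ffun4 c d (bvec p.2) (bvec p.1)) y.
Proof.
rewrite /= sum_crossing !ffunE /= sum_mxcoef; apply: eq_bigr => p _.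
by have [_ _ ->] := swap_at_ffun4 c d (bvec a) (bvec b) (bvec p.1) (bvec p.2).
Qed.

Lemma seifert_word3 : seifert_word 3 =
  [:: (0, true); (1, true); (2, true); (2, true); (1, true); (0, true)].
Proof.
rewrite /seifert_word !enum_ordSl /= (_ : enum 'I_0 = [::]); last first.
  by apply/eqP; rewrite -size_eq0 size_enum_ord.
by rewrite /= /rev /=; do !congr cons; congr pair; apply: val_inj.
Qed.

Lemma ffun4_eq (T : eqType) (a b c d a' b' c' d' : T) :
  (ffun4 a b c d == ffun4 a' b' c' d')
  = [&& a == a', b == b', c == c' & d == d'].
Proof.
apply/eqP/and4P => [H|[/eqP-> /eqP-> /eqP-> /eqP->] //].
by split; apply/eqP;
  [have := congr1 (fun x : {ffun _} => x 0) H
  |have := congr1 (fun x : {ffun _} => x 1) H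
  |have := congr1 (fun x : {ffun _} => x 2) H
  |have := congr1 (fun x : {ffun _} => x 3) H]; rewrite !ffunE.
Qed.

Lemma bvec_eq (k : 'I_r) (a b : 'I_k) : (bvec a == bvec b) = (a == b).
Proof. by rewrite -tag_eqE /tag_eq eqxx /= tagged_asE. Qed.

(** Strand 0 meets the meridians in [p1], [p2], [p3] and again, in reverse order, in [q3], [q2],
    [q1]. The delta closing up a meridian stands right after its second crossing, which is the
    nested form that [partial_trace] expects. *)
Lemma braid_coef_seifert3 (k l1 l2 l3 : 'I_r) (a : 'I_k) (b : 'I_l1)
    (c : 'I_l2) (d : 'I_l3) :
  let x := ffun4 (bvec a) (bvec b) (bvec c) (bvec d) in
  braid_coef R (seifert_word 3) x x =
  \sum_(p1 : 'I_k * 'I_l1) Rm k l1 p1 (a, b) *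
  \sum_(p2 : 'I_k * 'I_l2) Rm k l2 p2 (p1.1, c) *
  \sum_(p3 : 'I_k * 'I_l3) Rm k l3 p3 (p2.1, d) *
  \sum_(q3 : 'I_l3 * 'I_k) Rm l3 k q3 (p3.2, p3.1) * ((q3.1 == d)%:R *
  \sum_(q2 : 'I_l2 * 'I_k) Rm l2 k q2 (p2.2, q3.2) * ((q2.1 == c)%:R *
  \sum_(q1 : 'I_l1 * 'I_k) Rm l1 k q1 (p1.2, q2.2) *
    ((q1.1 == b)%:R * (q1.2 == a)%:R))).
Proof.
move=> x; rewrite seifert_word3 {1}/x braid_coef0; apply: eq_bigr => p1 _.
rewrite braid_coef1; congr (_ * _); apply: eq_bigr => p2 _.
rewrite braid_coef2; congr (_ * _); apply: eq_bigr => p3 _.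
rewrite braid_coef2; congr (_ * _); apply: eq_bigr => q3 _.
rewrite braid_coef1; congr (_ * _); rewrite mulr_sumr; apply: eq_bigr => q2 _.
rewrite braid_coef0 [RHS]mulrCA; congr (_ * _); rewrite !mulr_sumr.
apply: eq_bigr => q1 _; rewrite /= ffun4_eq !bvec_eq.
rewrite [RHS]mulrA [RHS]mulrCA -!natrM; congr (_ * _%:R).
by do 4?case: (_ == _).
Qed.

Lemma sum_push (I J : finType) (A : I -> C) (W : J -> C) (Y : I -> J -> C) :
  \sum_j W j * (\sum_i A i * Y i j) = \sum_i A i * (\sum_j W j * Y i j).
Proof.
under eq_bigr => j _ do rewrite mulr_sumr.
rewrite exchange_big; apply: eq_bigr => i _; rewrite mulr_sumr.
by apply: eq_bigr => j _; rewrite mulrCA.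
Qed.

Hypothesis r_gt1 : (1 < r)%N.

(** The meridians are removed by [partial_trace] from the innermost outwards: [l3], [l2], [l1]. The
    function [h] is each time the rest of the braid, and [sum_push] carries the quantum trace to the
    crossings it acts on. *)
Lemma trace_seifert3 (k l1 l2 l3 : 'I_r) (a : 'I_k) : (0 < k)%N ->
  \sum_(b < l1) s ^ wt l1 b * (\sum_(c < l2) s ^ wt l2 c *
    (\sum_(d < l3) s ^ wt l3 d *
    let x := ffun4 (bvec a) (bvec b) (bvec c) (bvec d) in
    braid_coef R (seifert_word 3) x x)) =
  (qint R r (k * l1) / qint R r k) * (qint R r (k * l2) / qint R r k)
  * (qint R r (k * l3) / qint R r k).
Proof.
move=> k0; have kr : (0 < k < r)%N by rewrite k0 ltn_ord.
set T1 := _ / _; set T2 := _ / _; set T3 := _ / _.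
transitivity (\sum_(b < l1) s ^ wt l1 b *
  \sum_(p1 : 'I_k * 'I_l1) Rm k l1 p1 (a, b) *
  (T2 * T3 * \sum_(q1 : 'I_l1 * 'I_k) Rm l1 k q1 (p1.2, p1.1) *
    ((q1.1 == b)%:R * (q1.2 == a)%:R))); last first.
  under eq_bigr => b _.
    under eq_bigr => p1 _ do rewrite mulrCA.
    rewrite -mulr_sumr mulrCA.
  over.
  rewrite -mulr_sumr (partial_trace r_gt1 l1 a (fun a' => (a' == a)%:R)) //.
  by rewrite eqxx mulr1 mulrC mulrA.
apply: eq_bigr => b _; congr (_ * _).
transitivity (\sum_(c < l2) s ^ wt l2 c *
  \sum_(p1 : 'I_k * 'I_l1) Rm k l1 p1 (a, b) *
  \sum_(p2 : 'I_k * 'I_l2) Rm k l2 p2 (p1.1, c) *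
   (T3 * \sum_(q2 : 'I_l2 * 'I_k) Rm l2 k q2 (p2.2, p2.1) * ((q2.1 == c)%:R *
  \sum_(q1 : 'I_l1 * 'I_k) Rm l1 k q1 (p1.2, q2.2) *
    ((q1.1 == b)%:R * (q1.2 == a)%:R)))).
  apply: eq_bigr => c _; congr (_ * _).
  under eq_bigr => d _ do rewrite /= braid_coef_seifert3.
  rewrite sum_push; apply: eq_bigr => p1 _; congr (_ * _).
  rewrite sum_push; apply: eq_bigr => p2 _; congr (_ * _).
  rewrite (partial_trace r_gt1 l3 p2.1 (fun x => 
    \sum_(q2 : 'I_l2 * 'I_k) Rm l2 k q2 (p2.2, x) * ((q2.1 == c)%:R *
    \sum_(q1 : 'I_l1 * 'I_k) Rm l1 k q1 (p1.2, q2.2) *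
    ((q1.1 == b)%:R * (q1.2 == a)%:R)))) //.
rewrite sum_push; apply: eq_bigr => p1 _; congr (_ * _).
under eq_bigr => c _.
  under eq_bigr => p2 _ do rewrite mulrCA.
  rewrite -mulr_sumr mulrCA.
over.
rewrite -mulr_sumr (partial_trace r_gt1 l2 p1.1 (fun x =>
    \sum_(q1 : 'I_l1 * 'I_k) Rm l1 k q1 (p1.2, x) *
    ((q1.1 == b)%:R * (q1.2 == a)%:R))) //.
by rewrite mulrA [T3 * _]mulrC.
Qed.

End Braids.

(** With one strand per component there are no self-crossings, so the blackboard framing is 0. *)
Lemma crossing_sum_self m N (w : seq (letter m)) (c : 'I_m.+1 -> 'I_N) a :
  injective c -> crossing_sum w c a a = 0.
Proof.
elim: w c => [|g w IHw] c c_inj //=.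
rewrite IHw ?addr0; last by move=> i j /c_inj/perm_inj.
case: ifP => //; rewrite orbb xpair_eqE => /andP[/eqP El /eqP Er].
by case/eqP: (posl_neq_posr g.1); apply: c_inj; rewrite El.
Qed.

Lemma big_ffun1 (V : nmodType) (T : finType) (P : pred T)
    (f : {ffun 'I_1 -> T} -> V) :
  \sum_(x : {ffun 'I_1 -> T} | [forall i, P (x i)]) f x =
  \sum_(a | P a) f [ffun=> a].
Proof.
rewrite (reindex (fun a => [ffun=> a])) /=.
  apply: eq_bigl => a; apply/forallP/idP => [/(_ ord0)|Ha i]; by rewrite ffunE.
exists (fun x : {ffun 'I_1 -> T} => x ord0) => [a|x] _; first by rewrite ffunE.
by apply/ffunP => i; rewrite ffunE (ord1 i).
Qed.

(** * Sums over the colors *)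

Section JonesSums.
Variables (R : realType) (r : nat).
Hypothesis r_gt1 : (1 < r)%N.
Local Notation C := R[i].
Local Notation s := (qs R r).
Local Notation t := (qt R r).

(** This is the S_p(k) of the overview; at [k = 1] it is also the sum for the unknot with framing
    [p]. *)
Definition meridian_sum (p : int) (k : nat) : C :=
  \sum_(j < r | odd j) qint R r j * qint R r (k * j) * t ^ (p * (j%:Z ^+ 2 - 1)).

Lemma sum_qs_wt k : \sum_(a < k) s ^ wt k a = qint R r k.
Proof.
have := @sum_weights _ s t (qt_sqr R r_gt1) (qt_neq0 R r) (qs_subV_neq0 R r_gt1) 1 k.
rewrite mul1n expr1 => /(_ (qs_subV_neq0 R r_gt1)).
rewrite qint_qz [X in _ / X](_ : _ = 1) ?divr1 => [<-|]; last first.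
  by rewrite /qz -exprnN expr1z divff ?qs_subV_neq0.
by apply: eq_bigr => a _; rewrite mul1r.
Qed.

Lemma jones_sum_unknot f : jones_sum R r (unknot f) = meridian_sum f 1.
Proof.
transitivity (\sum_(k : {ffun 'I_1 -> 'I_r} | [forall a, odd (k a)])
  (\prod_(a < 1) qint R r (k a)) * @colored_jones R r (unknot f) k) => //.
rewrite (big_ffun1 (fun j : 'I_r => odd j)); apply: eq_bigr => j j_odd.
rewrite big_ord_recl big_ord0 mulr1 ffunE mul1n -mulrA; congr (_ * _).
rewrite /colored_jones /= big_ord_recl big_ord0 mulr1 ffunE subr0 mulrC.
congr (_ * _).
transitivity (\sum_(x : {ffun 'I_1 -> colvec r} | [forall i, tag (x i) == j])
    (\prod_(i < 1) s ^ wt (tag (x i)) (tagged (x i))) * (x == x)%:R).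
  by apply: eq_bigl => x; apply: eq_forallb => i /=; rewrite ?ffunE.
rewrite (big_ffun1 (fun u : colvec r => tag u == j)
  (fun x => (\prod_(i < 1) s ^ wt (tag (x i)) (tagged (x i))) * (x == x)%:R)).
rewrite sum_tag.
under eq_bigr => a _ do rewrite big_ord_recl big_ord0 !mulr1 ffunE /= eqxx mulr1.
exact: sum_qs_wt.
Qed.

Lemma colored_jones_Xtref0 (k0 k1 k2 k3 : 'I_r) : (0 < k0)%N ->
  @colored_jones R r Xtref0 (ffun4 k0 k1 k2 k3) =
  t ^ (-2 * (k1%:Z ^+ 2 - 1)) * t ^ (3 * (k2%:Z ^+ 2 - 1))
  * t ^ (6 * (k3%:Z ^+ 2 - 1))
  * (qint R r k0 * ((qint R r (k0 * k1) / qint R r k0) *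
      (qint R r (k0 * k2) / qint R r k0) * (qint R r (k0 * k3) / qint R r k0))).
Proof.
move=> k0_gt0; rewrite /colored_jones.
congr (_ * _).
  under eq_bigr => a _ do rewrite crossing_sum_self // subr0.
  by rewrite !big_ord_recl big_ord0 /= mul0r expr0z mul1r mulr1 !ffunE /= !mulrA.
rewrite (eq_bigl (fun x : {ffun 'I_4 -> colvec r} =>
   [forall i, tag (x i) == ffun4 k0 k1 k2 k3 i])) //.
rewrite (big_ffun4 (fun i => [pred u | tag u == ffun4 k0 k1 k2 k3 i])).
rewrite /= !ffunE /= sum_tag.
transitivity (\sum_(a < k0) s ^ wt k0 a *  ((qint R r (k0 * k1) / qint R r k0) *
      (qint R r (k0 * k2) / qint R r k0) * (qint R r (k0 * k3) / qint R r k0))).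
  apply: eq_bigr => a _.
  rewrite -(@trace_seifert3 R r r_gt1 k0 k1 k2 k3 a k0_gt0) mulr_sumr sum_tag.
  apply: eq_bigr => b _; rewrite sum_tag !mulr_sumr.
  apply: eq_bigr => c _; rewrite sum_tag !mulr_sumr.
  apply: eq_bigr => d _.
  by rewrite !big_ord_recl big_ord0 /= !ffunE /= mulr1 -!mulrA.
rewrite -mulr_suml; congr (_ * _); exact: sum_qs_wt.
Qed.

(** The weight and the closure of strand 0 each give [k], against one denominator [k] for each of
    the three meridians. *)
Lemma jones_sum_Xtref0 : jones_sum R r Xtref0 =
  \sum_(k < r | odd k) (qint R r k)^-1 *
    (meridian_sum (-2) k * meridian_sum 3 k * meridian_sum 6 k).
Proof.
transitivity (\sum_(k : {ffun 'I_4 -> 'I_r} | [forall a, odd (k a)])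
  (\prod_(a < 4) qint R r (k a)) * @colored_jones R r Xtref0 k) => //.
rewrite (big_ffun4 (fun _ (j : 'I_r) => odd j)); apply: eq_bigr => k k_odd.
have k_gt0 : (0 < k)%N by case: (nat_of_ord k) k_odd.
have k0 : qint R r k != 0 by rewrite qint_neq0 // k_gt0 ltn_ord.
rewrite /meridian_sum !mulr_suml !mulr_sumr; apply: eq_bigr => a _.
rewrite -mulrA mulrCA [in RHS]mulr_suml !mulr_sumr; apply: eq_bigr => b _.
rewrite !mulr_sumr; apply: eq_bigr => c _.
rewrite colored_jones_Xtref0 // !big_ord_recl big_ord0 !ffunE /=.
set x := t ^ _; set y := t ^ _; set z := t ^ _.
by field.
Qed.

End JonesSums.

(** * Signature of the linking matrix *)

Lemma linking_matrix_Xtref0 :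
  linking_matrix Xtref0 =
  \matrix_(i < 4, j < 4) if i == j then nth 0 [:: 0; -2; 3; 6] i else
    ((i == 0) || (j == 0))%:R.
Proof.
apply/matrixP => i j; rewrite !mxE; case: eqVneq => // /=.
rewrite seifert_word3 /=.
by case: i j => [[|[|[|[|//]]]] ?] [[|[|[|[|//]]]] ?]; rewrite //= !permE.
Qed.

Section Signature.
Variable R : realType.
Local Notation C := R[i].
Local Notation A := (map_mx intr (linking_matrix Xtref0) : 'M[C]_4).

Lemma mem_eigenvalues n (B : 'M[int]_n) (z : C) :
  eigenvalue (map_mx intr B : 'M[C]_n) z -> z \in eigenvalues R B.
Proof.
rewrite eigenvalue_root_char /eigenvalues.
case: closed_field_poly_normal => rs /= ->.
by rewrite (monicP (char_poly_monic _)) scale1r root_prod_XsubC.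
Qed.

Lemma size_eigenvalues n (B : 'M[int]_n) : size (eigenvalues R B) = n.
Proof.
rewrite /eigenvalues; case: closed_field_poly_normal => rs /= H.
apply: succn_inj; rewrite -(size_char_poly (map_mx intr B : 'M[C]_n)) H.
by rewrite (monicP (char_poly_monic _)) scale1r size_prod_XsubC.
Qed.

(** The list [eigenvalues] comes from an unspecified factorization, but [n] distinct eigenvalues
    must exhaust it. *)
Lemma perm_eigenvalues n (B : 'M[int]_n) (zs : seq C) :
  uniq zs -> size zs = n ->
  {in zs, forall z, eigenvalue (map_mx intr B : 'M[C]_n) z} ->
  perm_eq (eigenvalues R B) zs.
Proof.
move=> zs_uniq sz zsB.
have sub : {subset zs <= eigenvalues R B}.
  by move=> z /zsB/mem_eigenvalues.
have [|E1 E2] := uniq_min_size zs_uniq sub; first by rewrite size_eigenvalues sz.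
apply: uniq_perm => [||z]; last by rewrite E2.
  by rewrite (uniq_size_uniq zs_uniq E2) E1.
by [].
Qed.

(* The eigenvector for x is (1, 1/(x+2), 1/(x-3), 1/(x-6)). *)
Lemma eigenvalue_Xtref0 (x : R) :
  x + 2 != 0 -> x - 3 != 0 -> x - 6 != 0 ->
  x * (x ^+ 3 - 7 * x ^+ 2 - 3 * x + 50) = 0 ->
  eigenvalue A x%:C%C.
Proof.
move=> x1 x2 x3 Hx; apply/eigenvalueP.
exists (\row_j (nth 0 [:: 1; (x + 2)^-1; (x - 3)^-1; (x - 6)^-1] j)%:C%C); last first.
  apply/eqP => /rowP/(_ 0); rewrite !mxE /= => /eqP.
  by rewrite oner_eq0.
apply/rowP => j; rewrite linking_matrix_Xtref0 !mxE !big_ord_recl big_ord0 !mxE.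
rewrite -!(rmorph_int (real_complex R)) -!rmorphM -(rmorph0 (real_complex R)).
rewrite -!rmorphD; congr (_%:C)%C.
case: j => [[|[|[|[|//]]]] ?] /=.
(* The first coordinate reads 1/(x+2) + 1/(x-3) + 1/(x-6) = x; with denominators cleared it is the
   quartic hypothesis. The other coordinates hold identically. *)
- apply/eqP; rewrite -subr_eq0; apply/eqP.
  transitivity (- (x * (x ^+ 3 - 7 * x ^+ 2 - 3 * x + 50))
    / ((x + 2) * (x - 3) * (x - 6))); last by rewrite Hx oppr0 mul0r.
  by field; rewrite x1 x2 x3.
- by field; rewrite x1 x2 x3.
- by field; rewrite x1 x2 x3.
by field; rewrite x1 x2 x3.
Qed.

(** The eigenvalues are 0 and the three roots of the cubic [p], which are located by sign
    changes. *)
Lemma inertia_Xtref0 : bpos R Xtref0 = 2 /\ bneg R Xtref0 = 1.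
Proof.
pose p : {poly R} := (('X - 7%:P) * 'X - 3%:P) * 'X + 50%:P.
have pE x : p.[x] = x ^+ 3 - 7 * x ^+ 2 - 3 * x + 50 
  by rewrite !(hornerD, hornerM, hornerN, hornerX, hornerC); ring.
(* The values of [p] at -3, -1, 3, 4, 5, 7 are -31, 45, 5, -10, -15, 29. *)
have [x1] : exists2 x, -3 <= x <= -1 & root p x.
  by apply: poly_ivt; rewrite ?pE; lra.
have [x2] : exists2 x, 3 <= x <= 4 & root (- p) x.
  by apply: poly_ivt; rewrite ?hornerN ?pE; lra.
have [x3] : exists2 x, 5 <= x <= 7 & root p x.
  by apply: poly_ivt; rewrite ?pE; lra.
rewrite rootN !rootE !pE => H3 /eqP E3 H2 /eqP E2 H1 /eqP E1.
(* The poles -2, 3, 6 of the eigenvector are not roots: [p] takes there the values 20, 5, -4. *)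
have N1 : x1 != -2 by apply: contra_eq_neq E1 => ->; lra.
have N2 : x2 != 3 by apply: contra_eq_neq E2 => ->; lra.
have N3 : x3 != 6 by apply: contra_eq_neq E3 => ->; lra.
have [M1 M2 M3] : [/\ eigenvalue A x1%:C%C, eigenvalue A x2%:C%C
    & eigenvalue A x3%:C%C].
  split; apply: eigenvalue_Xtref0; rewrite ?subr_eq0 ?addr_eq0 ?E1 ?E2 ?E3 ?mulr0 //.
  - by rewrite lt_eqF //; clear -H1; lra.
  - by rewrite lt_eqF //; clear -H1; lra.
  - by rewrite gt_eqF //; clear -H2; lra.
  - by rewrite lt_eqF //; clear -H2; lra.
  - by rewrite gt_eqF //; clear -H3; lra.
  by rewrite gt_eqF //; clear -H3; lra.
have M0 : eigenvalue A (0 : R)%:C%C.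
  by apply: eigenvalue_Xtref0; rewrite ?add0r ?oppr_eq0 ?pnatr_eq0 ?mul0r.
have x1_lt0 : x1 < 0 by clear -H1; lra.
have x2_gt0 : 0 < x2 by clear -H2; lra.
have x23 : x2 < x3 by clear -H2 H3; lra.
have P : perm_eq (eigenvalues R (linking_matrix Xtref0))
   [seq x%:C%C | x <- [:: x1; 0; x2; x3]].
  apply: (@perm_eigenvalues 4).
  - rewrite map_inj_uniq; last exact: fmorph_inj.
    by apply: lt_sorted_uniq; rewrite /= x1_lt0 x2_gt0 x23.
  - by rewrite size_map.
  move=> z /mapP[x + ->]; rewrite !in_cons in_nil orbF => /or4P[] /eqP ->;
    [exact M1 | exact M0 | exact M2 | exact M3].
have x3_gt0 := lt_trans x2_gt0 x23.
rewrite /bpos /bneg !(seq.permP P) !count_map /= !ltcR ltxx x1_lt0 x2_gt0 x3_gt0.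
by rewrite !ltNge !ltW.
Qed.
End Signature.

(** * Gauss sums *)

Section GaussSums.
Variables (A : finComNzRingType) (F : fieldType) (e : A -> F).
Hypothesis eD : forall x y, e (x + y) = e x * e y.
Hypothesis e_eq1 : forall x, (e x == 1) = (x == 0).

Lemma char0 : e 0 = 1.
Proof. by apply/eqP; rewrite e_eq1. Qed.

Lemma char_neq0 x : e x != 0.
Proof.
apply/eqP => H; have := eD x (- x).
by rewrite subrr char0 H mul0r => /eqP; rewrite oner_eq0.
Qed.

Lemma charN x : e (- x) = (e x)^-1.
Proof.
by apply: (mulfI (char_neq0 x)); rewrite -eD subrr char0 divff ?char_neq0.
Qed.

Lemma charMn x n : e (x *+ n) = e x ^+ n.
Proof.
by elim: n => [|n IHn]; rewrite ?char0 // mulrS eD IHn exprS.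
Qed.

(** Translating [x] by 1 multiplies the sum by [e a], and [e a - 1] is invertible in the field [F]
    even when [a] is a zero divisor. *)
Lemma sum_char a : \sum_x e (a * x) = if a == 0 then #|A|%:R else 0.
Proof.
case: eqP => [->|/eqP a0].
  by under eq_bigr => x _ do rewrite mul0r char0; rewrite sumr_const.
have ea : e a - 1 != 0 by rewrite subr_eq0 e_eq1.
apply/(mulfI ea)/eqP; rewrite mulr0 mulrBl mul1r subr_eq0; apply/eqP.
rewrite [RHS](reindex_inj (addrI 1)) mulr_sumr.
by apply: eq_bigr => x _; rewrite mulrDr mulr1 eD.
Qed.

Definition gauss (a : A) : F := \sum_x e (a * x ^+ 2).

Lemma gauss_quad (p p' k : A) : p * p' = 1 ->
  \sum_x e (p * x ^+ 2 + 2 * k * x) = e (- (p' * k ^+ 2)) * gauss p.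
Proof.
move=> pp'; rewrite /gauss [in RHS](reindex_inj (addIr (p' * k))) mulr_sumr.
apply: eq_bigr => x _; rewrite -eD; congr e.
transitivity (p * x ^+ 2 + 2 * (p * p') * k * x + (p * p' - 1) * p' * k ^+ 2).
  by rewrite pp'; ring.
by ring.
Qed.

Lemma sum_unit (V : nmodType) (u u' : A) (f : A -> V) : u * u' = 1 ->
  \sum_x f (u * x) = \sum_x f x.
Proof.
move=> uu'; rewrite [RHS](reindex (fun x => u * x)) //.
by exists (fun x => u' * x) => x _; rewrite mulrA ?[u' * u]mulrC uu' mul1r.
Qed.

Lemma gauss_square (a u u' : A) : u * u' = 1 -> gauss (a * u ^+ 2) = gauss a.
Proof.
move=> uu'; rewrite /gauss -(sum_unit (fun x => e (a * x ^+ 2)) uu').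
by apply: eq_bigr => x _; congr e; ring.
Qed.

Lemma gaussM a b : gauss a * gauss b = \sum_p e (a * p.1 ^+ 2 + b * p.2 ^+ 2).
Proof.
rewrite -(pair_bigA _ (fun x y => e (a * x ^+ 2 + b * y ^+ 2))) /=.
rewrite /gauss mulr_suml; apply: eq_bigr => x _; rewrite mulr_sumr.
by apply: eq_bigr => y _; rewrite eD.
Qed.

(** The determinant has inverse [D], and Cramer's rule inverts the substitution. *)
Lemma sum_linear (V : nmodType) (a b c d D : A) (f : A * A -> V) :
  (a * d - b * c) * D = 1 ->
  \sum_p f (a * p.1 + b * p.2, c * p.1 + d * p.2) = \sum_p f p.
Proof.
move=> HD; rewrite [RHS](reindex (fun p => (a * p.1 + b * p.2, c * p.1 + d * p.2))) //.
exists (fun p => (D * (d * p.1 - b * p.2), D * (a * p.2 - c * p.1))) => -[x y] _ /=;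
  congr pair.
- by rewrite -[RHS]mul1r -HD; ring.
- by rewrite -[RHS]mul1r -HD; ring.
- by rewrite -[RHS]mul1r -HD; ring.
- by rewrite -[RHS]mul1r -HD; ring.
Qed.

Variables (i2 i3 : A).
Hypotheses (i2E : 2 * i2 = 1) (i3E : 3 * i3 = 1).

(** The substitution (x + y, y) turns x^2 - y^2 into x^2 + 2xy; summing over y leaves only x = 0,
    since 2 is invertible. *)
Lemma gauss_norm : gauss 1 * gauss (- 1) = #|A|%:R.
Proof.
have H : (1 * 1 - 1 * 0) * 1 = 1 :> A by ring.
rewrite gaussM -(sum_linear (fun p => e (1 * p.1 ^+ 2 + -1 * p.2 ^+ 2)) H) /=.
rewrite (eq_bigr (fun p => e (p.1 ^+ 2) * e (2 * p.1 * p.2))); last first.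
  by move=> p _; rewrite -eD; congr e; ring.
rewrite -(pair_bigA _ (fun x y => e (x ^+ 2) * e (2 * x * y))) /=.
rewrite (bigD1 0) //= [X in _ + X]big1 ?addr0 => [|x x0].
  by rewrite -mulr_sumr sum_char mulr0 eqxx expr0n char0 mul1r.
rewrite -mulr_sumr sum_char; case: eqP => [/(congr1 ( *%R i2))|]; last by rewrite mulr0.
by rewrite mulr0 mulrA (mulrC i2) i2E mul1r => /eqP; rewrite (negPf x0).
Qed.

(* The quadratic form <3, 6> represents 9, hence is <9, 18>. *)
Lemma gauss_3_6 : gauss 3 * gauss 6 = gauss 1 * gauss 2.
Proof.
rewrite -(gauss_square 1 i3E) -(gauss_square 2 i3E) !gaussM.
(* The substitution (x + 2y, x - y) has determinant -3. *)
have H : (1 * -1 - 2 * 1) * - i3 = 1 :> A by rewrite -[RHS]i3E; ring.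
rewrite -(sum_linear (fun p => e (3 * p.1 ^+ 2 + 6 * p.2 ^+ 2)) H).
by apply: eq_bigr => p _ /=; congr e; ring.
Qed.

(* The quadratic form <2, -2> represents 16, hence is <16, -16>. *)
Lemma gauss_2_m2 : gauss 2 * gauss (- 2) = gauss 1 * gauss (- 1).
Proof.
have i4E : 4 * (i2 ^+ 2) = 1 :> A 
  by transitivity ((2 * i2) ^+ 2); [ring | rewrite i2E expr1n].
rewrite -(gauss_square 1 i4E) -(gauss_square (-1) i4E) !gaussM.
(* The substitution (3x + y, x + 3y) has determinant 8. *)
have H : (3 * 3 - 1 * 1) * (i2 ^+ 3) = 1 :> A.
  by transitivity ((2 * i2) ^+ 3); [ring | rewrite i2E expr1n].
rewrite -(sum_linear (fun p => e (2 * p.1 ^+ 2 + - 2 * p.2 ^+ 2)) H).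
by apply: eq_bigr => p _ /=; congr e; ring.
Qed.

Lemma gauss_m2_3_6 :
  gauss (- 2) * gauss 3 * gauss 6 = #|A|%:R * gauss 1.
Proof.
rewrite -mulrA gauss_3_6 -gauss_norm -gauss_2_m2; ring.
Qed.

(** This is {x}. For the character [zchar] and odd [n], [qb n / qb 1] is the quantum integer [n]. *)
Definition qb (x : A) : F := e (2 * x) - e (- (2 * x)).

Lemma qbN x : qb (- x) = - qb x.
Proof. by rewrite /qb mulrN opprK opprB. Qed.

Lemma qb0 : qb 0 = 0.
Proof. by rewrite /qb mulr0 oppr0 subrr. Qed.

(** The product of the two [qb] has four terms, with linear parts 2(k+1)x and 2(k-1)x up to sign.
    Opposite signs give the same Gauss sum, hence the factor 2, and the difference of the two values
    is a multiple of [qb (p' * k)]. *)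
Lemma sum_qb_gauss (p p' k : A) : p * p' = 1 ->
  \sum_x qb x * qb (k * x) * e (p * (x ^+ 2 - 1)) =
  - 2 * e (- p) * gauss p * e (- (p' * (k ^+ 2 + 1))) * qb (p' * k).
Proof.
move=> pp'.
rewrite (eq_bigr (fun x => e (- p) * (e (p * x ^+ 2 + 2 * (k + 1) * x)
  + e (p * x ^+ 2 + 2 * (- (k + 1)) * x) - e (p * x ^+ 2 + 2 * (k - 1) * x)
  - e (p * x ^+ 2 + 2 * (- (k - 1)) * x)))); last first.
  move=> x _; rewrite /qb.
  rewrite (_ : 2 * (k + 1) * x = 2 * (k * x) + 2 * x); last by ring.
  rewrite (_ : 2 * - (k + 1) * x = - (2 * (k * x)) - 2 * x); last by ring.
  rewrite (_ : 2 * (k - 1) * x = 2 * (k * x) - 2 * x); last by ring.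
  rewrite (_ : 2 * - (k - 1) * x = - (2 * (k * x)) + 2 * x); last by ring.
  rewrite (_ : p * (x ^+ 2 - 1) = p * x ^+ 2 - p); last by ring.
  by rewrite !eD; ring.
rewrite -mulr_sumr !big_split /= !sumrN !(gauss_quad _ pp').
have sq1 : - (p' * (k + 1) ^+ 2) = - (p' * (k ^+ 2 + 1)) - 2 * (p' * k) by ring.
have sq2 : - (p' * (k - 1) ^+ 2) = - (p' * (k ^+ 2 + 1)) + 2 * (p' * k) by ring.
by rewrite !sqrrN sq1 sq2 /qb !eD; ring.
Qed.

Variable r : nat.
Hypotheses (r_odd : odd r) (r_n3 : ~~ (3 %| r)%N) (cardA : #|A| = r).
Hypothesis natA : forall n, (n%:R == 0 :> A) = (r %| n)%N.
Hypothesis two_neq0 : 2 != 0 :> F.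

Lemma charX_card x : e x ^+ r = 1.
Proof.
rewrite -charMn -mulr_natr (_ : r%:R = 0) ?mulr0 ?char0 //.
by apply/eqP; rewrite natA.
Qed.

(* The case x = 0, where the left-hand side is 0 / 0 = 0, is not an exception. *)
Lemma qb_ratio x (v := e (4 * x)) :
  qb (3 * x) * qb (2 * x) * qb x / qb (6 * x) =
  1 - (v ^+ 2 + v) / 2 * \sum_(i < r) (- v ^+ 3) ^+ i.
Proof.
(* The product is 1 - (-v^3)^r, where [r] is odd and v^r = 1; so 1 + v^3 is invertible. *)
have geom : (1 + v ^+ 3) * (\sum_(i < r) (- v ^+ 3) ^+ i) = 2.
  rewrite -[1 + _]opprK opprD addrC mulNr -subrX1 -opprB opprK.
  by rewrite exprNn -signr_odd r_odd exprAC charX_card expr1n expr1; ring.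
have v3 : 1 + v ^+ 3 != 0.
  by apply: contraNneq two_neq0 => H; rewrite -geom H mul0r.
have -> : \sum_(i < r) (- v ^+ 3) ^+ i = 2 / (1 + v ^+ 3).
  by apply: (mulfI v3); rewrite geom mulrC divfK.
pose w := e (2 * x).
have qbw n : qb (n%:R * x) = w ^+ n - w ^- n.
  rewrite /qb charN (_ : 2 * (n%:R * x) = (2 * x) *+ n) ?charMn //; ring.
have vw : v = w ^+ 2 by rewrite /v /w -charMn; congr e; ring.
have w0 : w != 0 by exact: char_neq0.
rewrite vw in v3 *.
rewrite !qbw -[X in qb X]mul1r (qbw 1%N).
have [w6|w6] := eqVneq (w ^+ 6 - w ^- 6) 0.
  have x0 : x = 0.
    (* This says e(24 x) = 1, which forces [x = 0] as 2 and 3 are invertible. *)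
    have w12 : w ^+ 12 = 1.
      move/eqP: w6; rewrite subr_eq0 => /eqP w6.
      by rewrite (exprD w 6 6) {1}w6 mulVf ?expf_neq0.
    have /eqP : e ((2 * x) *+ 12) == 1 by rewrite charMn -/w w12.
    rewrite charMn => /eqP; rewrite -charMn e_eq1 => /eqP E.
    transitivity ((2 * i2) ^+ 3 * (3 * i3) * x).
      by rewrite i2E i3E expr1n !mul1r.
    transitivity (i2 ^+ 3 * i3 * ((2 * x) *+ 12)); first by ring.
    by rewrite E mulr0.
  by rewrite /w x0 mulr0 char0 !expr1n invr1 subrr !mulr0 mul0r; field.
field; rewrite v3 two_neq0 w0 (_ : _ - 1 = w ^+ 6 * (w ^+ 6 - w ^- 6)).
  by rewrite !mulf_neq0 ?expf_neq0.
by rewrite mulrBr divff ?expf_neq0 //; ring.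
Qed.

(** As 3 is invertible modulo [r], [i0] is the only index below [r] with a nonzero term. *)
Lemma alternating_sum (c i0 : nat) :
  (i0 < r)%N -> (r %| 3 * i0 + c)%N ->
  \sum_(i < r) (-1) ^+ i * (if (r %| 3 * i + c)%N then r%:R else 0 : F)
  = (-1) ^+ i0 * r%:R.
Proof.
move=> i0r Hi0; rewrite (bigD1 (Ordinal i0r)) //= Hi0 big1 ?addr0 // => i Hi.
case: ifP => [H|]; last by rewrite mulr0.
case/eqP: Hi; apply: val_inj => /=.
have diff a b : (a < r)%N -> (b < r)%N -> (r %| 3 * a + c)%N ->
    (r %| 3 * b + c)%N -> (b <= a)%N.
  move=> ar br Ha Hb; rewrite leqNgt; apply/negP => ab.
  have : (r %| b - a)%N.
    have co : coprime r 3 by rewrite coprime_sym prime_coprime.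
    rewrite -(Gauss_dvdr _ co) (_ : 3 * (b - a) = 3 * b + c - (3 * a + c))%N; last by lia.
    exact: dvdn_sub.
  by move/dvdn_leq; lia.
have ir := ltn_ord i.
by apply/eqP; rewrite eqn_leq (diff _ _ i0r ir Hi0 H) (diff _ _ ir i0r H Hi0).
Qed.

(** After the sums are exchanged, orthogonality keeps, for c = 1 and c = 2, the index i with 3i + c
    divisible by [r]; the total is r minus r/2 times the sum of the two signs. *)
Lemma sum_qb_ratio :
  \sum_x qb (3 * x) * qb (2 * x) * qb x / qb (6 * x) =
  if (r %% 3 == 1)%N then 0 else 2 * r%:R.
Proof.
under eq_bigr => x _ do rewrite qb_ratio.
rewrite sumrB sumr_const cardA.
have co4 : coprime r 4 by rewrite (@coprime_pexpr 2 r 2) // coprimen2.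
rewrite (eq_bigr (fun x => \sum_(i < r) 2^-1 * ((-1) ^+ i *
   (e ((4 * (3 * i + 2))%N%:R * x) + e ((4 * (3 * i + 1))%N%:R * x))))); last first.
  move=> x _; rewrite mulr_sumr; apply: eq_bigr => i _.
  have c4 m : (4 * m)%N%:R * x = (4 * x) *+ m by rewrite natrM mulrAC mulr_natr.
  by rewrite !c4 !charMn !(exprD _ (3 * i)) exprM [(- e _ ^+ 3) ^+ i]exprNn; ring.
rewrite exchange_big /=.
rewrite (eq_bigr (fun i : 'I_r =>
   2^-1 * ((-1) ^+ i * (if (r %| 3 * i + 2)%N then r%:R else 0)) +
   2^-1 * ((-1) ^+ i * (if (r %| 3 * i + 1)%N then r%:R else 0)))); last first.
  move=> i _; rewrite -!mulr_sumr big_split /= !sum_char !natA !Gauss_dvdr //.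
  by rewrite cardA !mulrDr.
rewrite big_split -!mulr_sumr /=.
have r3 : (r %% 3 < 3)%N by rewrite ltn_mod.
have rE := divn_eq r 3; set q := (r %/ 3)%N in rE.
move: r_n3; rewrite /dvdn; case: (r %% 3)%N r3 rE => [|[|[|//]]] // _ rE _.
  (* For r = 3q + 1, 3q + 1 = r and 3(2q) + 2 = 2r; [q] is even, so both signs are +1. *)
  rewrite (@alternating_sum 2 (2 * q)) ?(@alternating_sum 1 q) /=; try lia.
  - have q2 : ~~ odd q by lia.
    rewrite -(signr_odd _ q) -(signr_odd _ (2 * q)) oddM (negPf q2) expr0.
    by field; exact: two_neq0.
  - by rewrite (_ : 3 * q + 1 = r)%N //; lia.
  by apply/dvdnP; exists 2; lia.
(* For r = 3q + 2, 3q + 2 = r and 3(2q + 1) + 1 = 2r; [q] is odd, so both signs are -1. *)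
rewrite (@alternating_sum 2 q) ?(@alternating_sum 1 (2 * q + 1)) /=; try lia.
- have q2 : odd q by lia.
  rewrite -(signr_odd _ q) -(signr_odd _ (2 * q + 1)) addn1 /= oddM q2 expr1.
  by field; exact: two_neq0.
- by apply/dvdnP; exists 2; lia.
by rewrite (_ : 3 * q + 2 = r)%N //; lia.
Qed.

End GaussSums.

(** * Evaluation *)

(* On odd residues j in (0, r) and their opposites r - j, which are even, an
   even function has the same values. *)
Lemma sum_odd_Zp (F : fieldType) r (f : 'Z_r -> F) :
  (1 < r)%N -> odd r -> 2 != 0 :> F -> (forall x, f (- x) = f x) -> f 0 = 0 ->
  \sum_(j < r | odd j) f j%:R = 2^-1 * \sum_x f x.
Proof.
case: r f => [|[|m]] // f _ r_odd two_neq0 fN f0.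
apply: (mulfI two_neq0); rewrite mulrA divff // mul1r.
rewrite [RHS](bigID (fun x : 'I_m.+2 => odd x)) /=.
(* Negation exchanges odd and nonzero even residues; 0 is its own opposite and is split off. *)
rewrite [X in _ = _ + X](reindex_inj oppr_inj) /=.
rewrite [X in _ = _ + X](bigD1 0) /=; last by rewrite subn0 modnn.
rewrite fN f0 add0r mulr_natl mulr2n; congr (_ + _).
  by apply: eq_bigr => j _; rewrite natr_Zp.
apply: eq_big => [j|j _]; last by rewrite natr_Zp fN.
have [->|j0] := eqVneq j 0; first by rewrite andbF.
have jm := ltn_ord j; have j_gt0 : (0 < j)%N by rewrite lt0n.
rewrite andbT /= modn_small ; last by lia.
by rewrite oddB ?r_odd ?addTb ?negbK 1?ltnW.
Qed.

(** * A faithful character of Z/r *)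

Section Character.
Variables (R : realType) (r : nat).
Hypotheses (r_gt1 : (1 < r)%N) (r_odd : odd r).
Local Notation C := R[i].
Local Notation s := (qs R r).
Local Notation t := (qt R r).

(* A square root of -s among the r-th roots of unity. *)
Definition sqrt_Nqs : C := (- s) ^+ (uphalf r).
Local Notation y := sqrt_Nqs.

Lemma opp_qsX_r : (- s) ^+ r = 1.
Proof. by rewrite exprNn qsX_r // -signr_odd r_odd expr1 mulrNN mulr1. Qed.

Lemma sqrt_Nqs_sqr : y ^+ 2 = - s.
Proof.
rewrite -exprM (_ : uphalf r * 2 = r + 1)%N; last by rewrite muln2 uphalfE; lia.
by rewrite exprD opp_qsX_r mul1r expr1.
Qed.

Lemma sqrt_NqsX_r : y ^+ r = 1.
Proof. by rewrite exprAC opp_qsX_r expr1n. Qed.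

Lemma sqrt_Nqs_neq0 : y != 0.
Proof. by rewrite expf_neq0 // oppr_eq0 qs_neq0. Qed.

Definition zchar (x : 'Z_r) : C := y ^+ x.
Local Notation e := zchar.

Lemma zchar_nat n : e n%:R = y ^+ n.
Proof. by rewrite /zchar val_Zp_nat // expr_mod // sqrt_NqsX_r. Qed.

Lemma zcharD x x' : e (x + x') = e x * e x'.
Proof. by rewrite -[x]natr_Zp -[x']natr_Zp -natrD !zchar_nat exprD. Qed.

(** If y^x = 1 then s^(2x) = (y^x)^4 = 1, which is impossible for 0 < x < r. *)
Lemma zchar_eq1 x : (e x == 1) = (x == 0).
Proof.
apply/eqP/eqP => [H|->]; last by rewrite /zchar expr0.
apply/eqP; apply: contra_eqT H => x0; apply: contraTneq isT => H.
have Hx : (0 < x < r)%N by rewrite lt0n x0 -[X in (_ < X)%N](Zp_cast r_gt1) ltn_ord.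
have s2x : s ^+ x * s ^+ x = 1.
  transitivity ((y ^+ x) ^+ 4); last by rewrite -[y ^+ x]/(e x) H expr1n.
  by rewrite exprAC (exprM _ 2 2) sqrt_Nqs_sqr sqrrN expr2 exprMn.
have /eqP[] := qsX_subV_neq0 R r_gt1 Hx.
have sx0 : s ^+ x != 0 by rewrite expf_neq0 ?qs_neq0.
by apply: (mulfI sx0); rewrite mulrBr divff // s2x subrr mulr0.
Qed.

Lemma Zp_natr_eq0 n : (n%:R == 0 :> 'Z_r) = (r %| n)%N.
Proof. by rewrite -val_eqE /= val_Zp_nat. Qed.

Lemma card_Zp_ring : #|'Z_r| = r.
Proof. by rewrite card_ord Zp_cast. Qed.

Lemma zchar_int (m : int) : e m%:~R = y ^ m.
Proof.
case: m => n; first by rewrite -pmulrn zchar_nat.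
by rewrite NegzE mulrNz (charN zcharD zchar_eq1) zchar_nat exprnN.
Qed.

Local Notation qb := (qb e).

Lemma qb_natr n : qb n%:R = (- s) ^+ n - (- s) ^- n.
Proof.
rewrite /qb (charN zcharD zchar_eq1) -(natrM _ 2) zchar_nat exprM sqrt_Nqs_sqr //.
Qed.

Lemma qb1 : qb 1 = - (s - s^-1).
Proof. by rewrite (qb_natr 1) !expr1 invrN opprB opprK addrC. Qed.

(** For odd [n], replacing [s] by [- s] changes the sign of both numerator and denominator. *)
Lemma qint_qb n : odd n -> qint R r n = qb n%:R / qb 1.
Proof.
move=> n_odd; rewrite (qb_natr n) qb1 exprNn -signr_odd n_odd expr1 mulN1r.
by rewrite !invrN -opprD mulrNN.
Qed.

(** For odd [j] the exponent is a multiple of 4, and t^4 = s^2 = y^4. *)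
Lemma qt_framing p (j : nat) : odd j ->
  t ^ (p * (j%:Z ^+ 2 - 1)) = e (p%:~R * (j%:R ^+ 2 - 1)).
Proof.
move=> j_odd; have [z jz] : exists z : int, j%:Z ^+ 2 - 1 = 4 * z.
  have [k ->] : exists k, j = (k * 2 + 1)%N.
    by exists j./2; rewrite muln2 addn1 -[LHS]odd_double_half j_odd.
  by exists (k%:Z * (k%:Z + 1)); rewrite PoszD PoszM; ring.
transitivity (e ((p * (4 * z))%:~R)); last first.
  by rewrite -jz rmorphM rmorphB rmorphXn /= -pmulrn.
have expr4 (x : C) : x ^ (p * (4 * z)) = (x ^+ 4) ^ (p * z).
  by rewrite mulrCA -(exprz_exp x 4).
rewrite jz zchar_int !expr4 (exprM t 2 2) (exprM y 2 2) sqrt_Nqs_sqr sqrrN.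
by rewrite [t ^+ 2](qt_sqr R r_gt1).
Qed.

End Character.

(** * Closed forms of the color sums *)

Section Evaluation.
Variables (R : realType) (r : nat).
Hypotheses (r_gt1 : (1 < r)%N) (r_odd : odd r).
Local Notation C := R[i].
Local Notation s := (qs R r).
Local Notation y := (sqrt_Nqs R r).
Local Notation e := (@zchar R r).
Local Notation qb := (qb e).
Local Notation g := (gauss e).

Let eD := @zcharD R r r_gt1 r_odd.
Let e1 := @zchar_eq1 R r r_gt1 r_odd.

Let two_neq0 : 2 != 0 :> C. Proof. by rewrite pnatr_eq0. Qed.

Lemma qb1_neq0 : qb 1 != 0.
Proof. by rewrite qb1 // oppr_eq0 qs_subV_neq0. Qed.

(** Half of the value in [sum_qb_gauss], divided by [qb 1 ^+ 2]; [p'] stands for the inverse of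
    [p]. *)
Definition meridian_char (p p' x : 'Z_r) : C :=
  - (qb 1 ^- 2 * e (- p) * g p * e (- (p' * (x ^+ 2 + 1))) * qb (p' * x)).

Lemma meridian_sumE (p : int) (p' : 'Z_r) (k : nat) : odd k -> p%:~R * p' = 1 ->
  meridian_sum R r p k = meridian_char p%:~R p' k%:R.
Proof.
move=> k_odd pp'; pose f x := qb 1 ^- 2 *
  (qb x * qb (k%:R * x) * e (p%:~R * (x ^+ 2 - 1))).
transitivity (\sum_(j < r | odd j) f j%:R).
  apply: eq_bigr => j j_odd; rewrite (qint_qb _ _ _ j_odd) //.
  rewrite (qint_qb R r_gt1 r_odd (n := k * j)) ?oddM ?k_odd //.
  rewrite (qt_framing R r_gt1 r_odd p j_odd) natrM /f.
  by field; exact: qb1_neq0.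
rewrite sum_odd_Zp // => [|x|]; last by rewrite /f qb0 !mul0r mulr0.
  rewrite -mulr_sumr (sum_qb_gauss eD _ pp') /meridian_char.
  by field; exact: qb1_neq0.
by rewrite /f mulrN !qbN mulrNN sqrrN.
Qed.

Lemma jones_sum_unknotE (f : int) (f' : 'Z_r) : f%:~R * f' = 1 ->
  jones_sum R r (unknot f) = meridian_char f%:~R f' 1.
Proof. by move=> ff'; rewrite jones_sum_unknot // (meridian_sumE _ ff'). Qed.

Hypothesis r_n3 : ~~ (3 %| r)%N.

(** Substituting k = 6x turns k/2, k/3, k/6 into 3x, 2x, x. The constants e(-p) multiply to e(2 - 3
    - 6), and the sign of [qb (- (3 * x))] cancels the three signs of [meridian_char]. *)
Lemma jones_sum_Xtref0E : jones_sum R r Xtref0 =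
  2^-1 * qb 1 ^- 5 * e (- 7) * (r%:R * g 1) *
  (if (r %% 3 == 1)%N then 0 else 2 * r%:R).
Proof.
have unit n : coprime r n -> (n%:R : 'Z_r) \is a GRing.unit.
  by move=> co; rewrite unitZpE.
have i2E : 2 * 2^-1 = 1 :> 'Z_r by rewrite mulrV ?unit ?coprimen2.
have i3E : 3 * 3^-1 = 1 :> 'Z_r.
  by rewrite mulrV ?unit // coprime_sym prime_coprime.
set i2 : 'Z_r := 2^-1 in i2E; set i3 : 'Z_r := 3^-1 in i3E.
have i6E : 6 * (i2 * i3) = 1 :> 'Z_r.
  by transitivity ((2 * i2) * (3 * i3)); [ring | rewrite i2E i3E mulr1].
have m2E : (-2)%:~R * - i2 = 1 :> 'Z_r.
  by rewrite mulrNz mulrNN.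
pose M x := meridian_char (-2)%:~R (- i2) x * meridian_char 3 i3 x *
   meridian_char 6 (i2 * i3) x.
pose f x := qb 1 / qb x * M x.
transitivity (\sum_(k < r | odd k) f k%:R).
  rewrite jones_sum_Xtref0 //; apply: eq_bigr => k k_odd.
  rewrite (meridian_sumE k_odd m2E) (@meridian_sumE 3 i3 k) //.
  by rewrite (@meridian_sumE 6 (i2 * i3) k) // qint_qb // invf_div.
(* The summand is even because it has four odd factors, and [1 / qb 0 = 0] makes it vanish at 0. *)
rewrite sum_odd_Zp // => [|x|]; first last.
- by rewrite /f qb0 invr0 mulr0 mul0r.
- rewrite /f /M /meridian_char !mulrN !qbN sqrrN invrN.
  by ring.
rewrite -(sum_unit _ i6E).
rewrite -(@sum_qb_ratio _ _ _ eD e1 _ _ i2E i3E r) //; first last.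
- by move=> n; rewrite Zp_natr_eq0.
- exact: card_Zp_ring.
have Eg : g (-2) * g 3 * g 6 = r%:R * g 1.
  by rewrite (gauss_m2_3_6 eD e1 i2E i3E) card_Zp_ring.
rewrite -Eg -!mulrA; congr (_ * _); rewrite !mulrA [RHS]mulr_sumr; apply: eq_bigr => x _.
have [E3 E2] : i2 = 3 * (i2 * i3) /\ i3 = 2 * (i2 * i3).
  by rewrite mulrCA i3E mulr1 mulrA i2E mul1r.
have E3x : - i2 * (6 * x) = - (3 * x).
  by transitivity (- (3 * (2 * i2 * x))); [ring | rewrite i2E mul1r].
have E2x : i3 * (6 * x) = 2 * x.
  by transitivity (2 * (3 * i3 * x)); [ring | rewrite i3E mul1r].
have E1x : (i2 * i3) * (6 * x) = x by rewrite mulrA (mulrC _ 6) i6E mul1r.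
pose Q := (6 * x) ^+ 2 + 1.
(* The exponent is a multiple of -1/2 + 1/3 + 1/6 = 0. *)
have EQ : e (- (- i2 * Q)) * e (- (i3 * Q)) * e (- (i2 * i3 * Q)) = 1.
  rewrite -!eD -(char0 e1); congr e.
  by rewrite {1}E3 {2}E2; ring.
have E7 : e (- (-2)) * e (- 3) * e (- 6) = e (- 7).
  by rewrite -!eD; congr e; ring.
rewrite /f /M /meridian_char -/Q E3x E2x E1x (_ : (-2)%:~R = -2) //.
rewrite -E7 qbN.
transitivity (qb 1 ^- 5 * (e (- (-2)) * e (- 3) * e (- 6)) *
  (g (-2) * g 3 * g 6) * (qb (3 * x) * qb (2 * x) * qb x / qb (6 * x))
  * (e (- (- i2 * Q)) * e (- (i3 * Q)) * e (- (i2 * i3 * Q)))).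
  move: (qb (6 * x))^-1 => z.
  by field; exact: qb1_neq0.
by rewrite EQ mulr1; ring.
Qed.

Lemma jones_sum_unknot1 :
  jones_sum R r (unknot 1) = - (qb 1)^-1 * e (- 3) * g 1.
Proof.
rewrite (@jones_sum_unknotE 1 1) ?mulr1 // /meridian_char mul1r expr1n.
rewrite (_ : - 3 = - 1 - (1 + 1)) ?eD; last by ring.
by rewrite (_ : 1%:~R = 1) //; field; exact: qb1_neq0.
Qed.

Lemma jones_sum_unknotN1 :
  jones_sum R r (unknot (-1)) = (qb 1)^-1 * e 3 * g (- 1).
Proof.
rewrite (@jones_sum_unknotE (-1) (-1)) ?mulrN1z ?mulrNN ?mulr1 // /meridian_char.
rewrite !mulN1r expr1n !opprK qbN.
rewrite (_ : 3 = 1 + (1 + 1)) ?eD; last by ring.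
by field; exact: qb1_neq0.
Qed.

Lemma gauss1_neq0 : g 1 != 0 /\ g (- 1) != 0.
Proof.
have i2E : 2 * 2^-1 = 1 :> 'Z_r by rewrite mulrV ?unitZpE ?coprimen2.
apply/andP; rewrite -negb_or -mulf_eq0 (gauss_norm eD e1 i2E) card_Zp_ring //.
by rewrite pnatr_eq0 -lt0n ltnW.
Qed.

(** Here G_+^2 G_- = (qb 1)^-3 e(-3) r g(1), so the quotient keeps (qb 1)^-2 e(-4), where e(-4) =
    y^-4 = s^-2. *)
Lemma tau'_Xtref0E : tau' R r Xtref0 =
  (Num.sqrt (4 / r%:R) * sin (pi / r%:R))%:C%C * (s - s^-1) ^- 2 * s ^- 2 *
  (if (r %% 3 == 1)%N then 0 else r%:R).
Proof.
have [b2 b1] := inertia_Xtref0 R; have [g1 gN1] := gauss1_neq0.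
have y0 := sqrt_Nqs_neq0 R r; have D0 := qb1_neq0.
have i2E : 2 * 2^-1 = 1 :> 'Z_r by rewrite mulrV ?unitZpE ?coprimen2.
have Hg : r%:R = g 1 * g (- 1) by rewrite (gauss_norm eD e1 i2E) card_Zp_ring.
have eN n : e (- n%:R) = y ^- n by rewrite (charN eD e1) zchar_nat.
rewrite /tau' b2 b1 jones_sum_Xtref0E jones_sum_unknot1 jones_sum_unknotN1.
rewrite (eN 3) (eN 7) (zchar_nat _ _ _ 3) // {1}Hg.
rewrite -[s ^+ 2]sqrrN -sqrt_Nqs_sqr // -[(s - s^-1) ^+ 2]sqrrN -qb1 // /= expr1.
case: ifP => _; first by rewrite !mulr0 mul0r.
by field; rewrite y0 D0 g1 gN1.
Qed.

End Evaluation.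

Theorem mainTheorem4 (R : realType) (r : nat)
    (r_ge3 : (3 <= r)%N) (r_odd : odd r) (r_n3 : ~~ (3 %| r)%N) :
  ((r = 1 %[mod 3])%N -> tau' R r Xtref0 = 0)
  /\ ((r + 1 = 0 %[mod 3])%N ->
      tau' R r Xtref0 =
        (- Num.sqrt r%:R / (2 * sin (pi / r%:R)))%:C%C * cis (- (2 * pi / r%:R))).
Proof.
have r_gt1 : (1 < r)%N by lia.
rewrite (tau'_Xtref0E R r_gt1 r_odd r_n3); split => [->|r2]; first by rewrite mulr0.
have -> : (r %% 3 == 1)%N = false by lia.
have r_gt0 : 0 < r%:R :> R by rewrite ltr0n; lia.
set x := pi / r%:R.
have sin0 : sin x != 0.
  have := qs_subV_neq0 R r_gt1; rewrite /qs cis_sub_inv eq_complex /= negb_and eqxx /=.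
  by rewrite mulf_eq0 negb_or => /andP[].
(* The real factor becomes (2 / sqrt r) sin x times r / (-4 sin^2 x). *)
have -> : (qs R r - (qs R r)^-1) ^+ 2 = (- (4 * sin x ^+ 2))%:C%C.
  by rewrite /qs cis_sub_inv expr2; simpc; congr Complex; ring.
have -> : qs R r ^- 2 = cis (- (2 * pi / r%:R)).
  by rewrite /qs cisX -cisN mulrA.
rewrite mulrAC -(rmorph_nat (real_complex R) r) -fmorphV -!rmorphM.
congr (_%:C%C * _).
rewrite sqrtrM // sqrtrV ?ltW // (_ : 4 = 2 ^+ 2) ?sqrtr_sqr ?ger0_norm //; last by ring.
have s0 : Num.sqrt (r%:R : R) != 0 by rewrite sqrtr_eq0 -ltNge.
have := sqr_sqrtr (ltW r_gt0); move: (Num.sqrt _) s0 => q s0 <-.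
by field; rewrite sin0 s0.
Qed.
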